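(* There exist constants $0<p^{\rm Ab}_{\rm c}<1$ and $0<p^{\rm aB}_{\rm c}<1$ with the following properties. For the game ${\rm Ab}$: - $\lim_{n\to\infty}P^{\rm Ab}_n(p)=0$ if and only if $p<p^{\rm Ab}_{\rm c}$; - $\lim_{n\to\infty}P^{\rm Ab}_n(p)=1$ if $p>p^{\rm Ab}_{\rm c}$. For the game ${\rm aB}$: - $\lim_{n\to\infty}P^{\rm aB}_n(p)=0$ if $p<p^{\rm aB}_{\rm c}$; - $\lim_{n\to\infty}P^{\rm aB}_n(p)=1$ if and only if $p>p^{\rm aB}_{\rm c}$.
   Context: Fix $n\geq1$. Two players, Alice and Bob, alternately make moves, Alice first, each making $n$ moves; every move is a choice from $\{1,2\}$. Write Alice's moves as $a=(a_1,\dots,a_n)$ and Bob's as $b=(b_1,\dots,b_n)$, and let $|a|_1:=\#\{k:a_k=1\}$, $|b|_1:=\#\{k:b_k=1\}$. In the game ${\rm Ab}_n(p)$ the outcome is $(a,|b|_1)$; in the game ${\rm aB}_n(p)$ the outcome is $(|a|_1,b)$. To each possible outcome a winner is assigned independently at random: Bob with probability $p$, Alice with probability $1-p$. The players know this assignment and all previous moves. A winning strategy for Bob is a rule choosing each of his moves as a function of the previous moves that guarantees a win for Bob whatever Alice plays. $P^{\rm Ab}_n(p)$ and $P^{\rm aB}_n(p)$ denote the probabilities that Bob has a winning strategy in ${\rm Ab}_n(p)$ and ${\rm aB}_n(p)$, respectively. *)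

(* Defs.v *)
From HB Require Import structures.
From mathcomp Require Import all_boot all_order all_algebra.
From mathcomp Require Import all_classical all_reals all_analysis.
Set Implicit Arguments. Unset Strict Implicit. Unset Printing Implicit Defensive.
Import Order.TTheory GRing.Theory Num.Theory.
Local Open Scope ring_scope.

(* Moves: a move in {1,2} is encoded as a bool, [true] meaning "1" and
   [false] meaning "2".  Hence |x|_1 = count id x. *)

(* A strategy for Bob: his move is a function of all previous moves, i.e.
   of Alice's moves so far (including her current move) and of Bob's own
   previous moves. *)
Definition strategy := seq bool -> seq bool -> bool.

Fixpoint play_aux (s : strategy) (as_ prevA prevB : seq bool) : seq bool :=
  match as_ with
  | [::] => [::]
  | x :: r => let pa := rcons prevA x in
              let y := s pa prevB in
              y :: play_aux s r pa (rcons prevB y)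
  end.

Definition bob_moves (n : nat) (s : strategy) (a : n.-tuple bool) : n.-tuple bool :=
  [tuple nth false (play_aux s a [::] [::]) i | i < n].

Definition ones (n : nat) (x : n.-tuple bool) : 'I_n.+1 := inord (count id x).

Definition outAb (n : nat) := (n.-tuple bool * 'I_n.+1)%type.
Definition outaB (n : nat) := ('I_n.+1 * n.-tuple bool)%type.

Definition bob_wins_Ab (n : nat) (W : {ffun outAb n -> bool}) : Prop :=
  exists s : strategy, forall a : n.-tuple bool, W (a, ones (bob_moves s a)).

Definition bob_wins_aB (n : nat) (W : {ffun outaB n -> bool}) : Prop :=
  exists s : strategy, forall a : n.-tuple bool, W (ones a, bob_moves s a).

Definition weight (R : realType) (T : finType) (p : R) (W : {ffun T -> bool}) : R :=
  \prod_(o : T) (if W o then p else 1 - p).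

Definition P_Ab (R : realType) (n : nat) (p : R) : R :=
  \sum_(W : {ffun outAb n -> bool}) weight p W * (`[< bob_wins_Ab W >])%:R.

Definition P_aB (R : realType) (n : nat) (p : R) : R :=
  \sum_(W : {ffun outaB n -> bool}) weight p W * (`[< bob_wins_aB W >])%:R.

(* Main.v *)
Require Import Defs.
From HB Require Import structures.
From mathcomp Require Import all_boot all_order all_algebra.
From mathcomp Require Import all_classical all_reals all_analysis.
From mathcomp Require Import zify ring lra.
Import Order.TTheory GRing.Theory Num.Theory.
Import numFieldNormedType.Exports.
Local Open Scope classical_set_scope.
Local Open Scope ring_scope.
(* Write 1 for an outcome won by Bob.  Backward induction turns Ab into a random
   cellular automaton: if [x] and [y] are independent copies of the vector of
   winners (indexed by |b|_1) with m rounds to go, then with m+1 rounds to go it is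
   k |-> (x_k \/ x_(k+1)) /\ (y_k \/ y_(k+1)), started from i.i.d. bits.  Let
   rho_m(p) be the probability that a given bit is 1.

   - Since rho_(m+1) <= 4 rho_m^2, rho_m(p) -> 0 as soon as some rho_m(p) < 1/4;
     this condition is open in p, so it describes [p < pc].
   - Sharpness.  For a monotone event F let M be its probability and D the
     derivative of M in p.  Entropy is sub-additive, hence D >= M log (1/M) and
     D >= (1-M) log (1/(1-M)).  On the other hand F is a symmetric function of the
     two copies, and a boolean function always has a second-order Hoeffding
     component of norm bounded below in terms of v = M(1-M), so a bound
     D >= l v at step m becomes D >= l (v + v^2/9) at step m+1.  The first bound
     beats t v when v is small, the second improves l otherwise; together they
     give D >= (t/2) v for every t once m is large, uniformly in p and F.
     As rho_m >= 1/4 at every p0 > pc, the mean value theorem forces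
     rho_m(p) -> 1 for p > p0.
   - pc < 1.  The probability that the runs of a set B are all lost and right-maximal
     is at most K_m^(number of runs) c_m^|B|: a lost run splits into alternating
     runs lost in each copy, and each of these is lengthened by one a step earlier.
     This yields K_(m+1) = 2 c_m K_m and c_(m+1) = c_m (1 + c_m K_m).
   - Exchanging the players, aB with parameter p is Ab with parameter (1-p)^2
     followed by one OR, so its threshold is 1 - sqrt pc. *)

Set Implicit Arguments.
Unset Strict Implicit.
Unset Printing Implicit Defensive.

(** * Means over the automaton as linear functionals *)

(* [EB p j f] is the mean of [f] over [j] independent bits of parameter [p];
   [EX st p m j f] is its mean over the first [j] bits of the automaton [st] after
   [m] steps. *)
Fixpoint EB {R : realType} (p : R) (j : nat) (f : seq bool -> R) : R :=
  if j is j'.+1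
  then p * EB p j' (fun x => f (true :: x))
       + (1 - p) * EB p j' (fun x => f (false :: x))
  else f [::].

Fixpoint EX {R : realType} (st : seq bool -> seq bool -> seq bool) (p : R)
    (m j : nat) (f : seq bool -> R) : R :=
  if m is m'.+1
  then EX st p m' j.+1 (fun x => EX st p m' j.+1 (fun y => f (st x y)))
  else EB p j f.

Definition orN (x : seq bool) : seq bool :=
  [seq u.1 || u.2 | u <- zip x (behead x)].
Definition andS (x y : seq bool) : seq bool := [seq u.1 && u.2 | u <- zip x y].
(** One round of Ab: Alice's move selects one of two disjoint families of outcomes, hence the AND of
    two copies; Bob's answer raises the counter by 0 or 1, hence the OR of neighbours. *)
Definition stepA (x y : seq bool) : seq bool := andS (orN x) (orN y).

Lemma size_orN x : size (orN x) = (size x).-1.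
Proof. by rewrite size_map size_zip size_behead; lia. Qed.

Lemma size_andS x y : size x = size y -> size (andS x y) = size x.
Proof. by move=> e; rewrite size_map size_zip e minnn. Qed.

Lemma size_stepA j x y :
  size x = j.+1 -> size y = j.+1 -> size (stepA x y) = j.
Proof. by move=> hx hy; rewrite size_andS !size_orN ?hx ?hy. Qed.

Lemma orN_cons a b x : orN (a :: b :: x) = (a || b) :: orN (b :: x).
Proof. by []. Qed.

Lemma stepAC x y : stepA x y = stepA y x.
Proof.
rewrite /stepA; elim: (orN x) (orN y) => [|a u IH] [|b v] //=.
by rewrite /andS /= andbC; congr cons; apply: IH.
Qed.

(** Under this condition [EX st p m j] evaluates its argument at words of size [j] only, so
    pointwise hypotheses may be restricted to that size. *)
Definition shrinks (st : seq bool -> seq bool -> seq bool) :=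
  forall j x y, size x = j.+1 -> size y = j.+1 -> size (st x y) = j.

Lemma shrinks_stepA : shrinks stepA. Proof. exact: size_stepA. Qed.

Definition linearF {R : realType} (L : (seq bool -> R) -> R) :=
  forall a f g, L (fun x => a * f x + g x) = a * L f + L g.

Lemma linearF0 {R : realType} (L : (seq bool -> R) -> R) :
  linearF L -> L (fun=> 0) = 0.
Proof.
move=> h; have := h 1 (fun=> 0) (fun=> 0).
rewrite (_ : (fun _ => _) = (fun=> 0)); last by apply/funext => x; rewrite mul1r addr0.
by rewrite mul1r => e; lra.
Qed.

Lemma linearFZ {R : realType} (L : (seq bool -> R) -> R) a f :
  linearF L -> L (fun x => a * f x) = a * L f.
Proof.
move=> h; rewrite -[RHS]addr0 -(linearF0 h) -h.
by congr (L _); apply/funext => x; rewrite addr0.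
Qed.

Lemma linearFD {R : realType} (L : (seq bool -> R) -> R) f g :
  linearF L -> L (fun x => f x + g x) = L f + L g.
Proof.
move=> h; rewrite -[L f]mul1r -h.
by congr (L _); apply/funext => x; rewrite mul1r.
Qed.

Lemma linearFB {R : realType} (L : (seq bool -> R) -> R) f g :
  linearF L -> L (fun x => f x - g x) = L f - L g.
Proof.
move=> h; have := h (-1) g f; rewrite mulN1r addrC => <-.
by congr (L _); apply/funext => x; rewrite mulN1r addrC.
Qed.

Lemma linearF_sum {R : realType} (L : (seq bool -> R) -> R) (I : Type)
    (r : seq I) (f : I -> seq bool -> R) : linearF L ->
  L (fun x => \sum_(i <- r) f i x) = \sum_(i <- r) L (f i).
Proof.
move=> h; elim: r => [|i r IH].
  rewrite big_nil -[RHS](linearF0 h); congr (L _); apply/funext => x.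
  by rewrite big_nil.
rewrite big_cons -IH -linearFD //; congr (L _); apply/funext => x.
by rewrite big_cons.
Qed.

Lemma linearF_EB {R : realType} (p : R) j : linearF (EB p j).
Proof. by elim: j => [//|j IH] a f g /=; rewrite !IH; ring. Qed.

Lemma linearF_EX {R : realType} st (p : R) m j : linearF (EX st p m j).
Proof.
elim: m j => [|m IH] j a f g /=; first exact: linearF_EB.
rewrite -IH; congr EX; apply/funext => x; exact: IH.
Qed.

(** Fubini in linear form: [EB p j] is a finite combination of evaluations, so every linear
    functional passes through it, derivatives as well as means. *)
Lemma EB_comm {R : realType} (p : R) j L (f : seq bool -> seq bool -> R) :
  linearF L ->
  L (fun y => EB p j (fun x => f x y)) = EB p j (fun x => L (fun y => f x y)).
Proof.
move=> h; elim: j f => [//|j IH] f /=.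
by rewrite linearFD // !linearFZ // !IH.
Qed.

Lemma EX_comm {R : realType} st (p : R) m j L (f : seq bool -> seq bool -> R) :
  linearF L ->
  L (fun y => EX st p m j (fun x => f x y))
  = EX st p m j (fun x => L (fun y => f x y)).
Proof.
move=> h; elim: m j f => [|m IH] j f /=; first exact: EB_comm.
rewrite IH; congr EX; apply/funext => x; exact: IH.
Qed.

Lemma EB_le {R : realType} (p : R) j f g : 0 <= p <= 1 ->
  (forall x, size x = j -> f x <= g x) -> EB p j f <= EB p j g.
Proof.
move=> hp; elim: j f g => [|j IH] f g h /=; first exact: h.
apply: lerD; apply: ler_wpM2l; try lra;
  by apply: IH => x sx; apply: h; rewrite /= sx.
Qed.

Lemma EX_le {R : realType} st (p : R) m j f g : shrinks st -> 0 <= p <= 1 ->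
  (forall x, size x = j -> f x <= g x) -> EX st p m j f <= EX st p m j g.
Proof.
move=> hst hp; elim: m j f g => [|m IH] j f g h /=; first exact: EB_le.
apply: (IH) => x sx; apply: (IH) => y sy; exact/h/hst.
Qed.

Lemma EB_cst {R : realType} (p : R) j c : EB p j (fun=> c) = c.
Proof. elim: j => [|j IH] /=; [by []|by rewrite IH; ring]. Qed.

Lemma EX_cst {R : realType} st (p : R) m j c : EX st p m j (fun=> c) = c.
Proof.
elim: m j => [|m IH] j /=; first exact: EB_cst.
by rewrite (_ : (fun _ => _) = (fun=> c)) //; apply/funext => x; rewrite IH.
Qed.

Lemma EX_eq {R : realType} st (p : R) m j f g : shrinks st ->
  (forall x, size x = j -> f x = g x) -> EX st p m j f = EX st p m j g.
Proof.
move=> hst; elim: m j f g => [|m IH] j f g h /=.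
  elim: j f g h => [|j IH] f g h /=; first exact: h.
  by congr (_ * _ + _ * _); apply: IH => x sx; apply: h; rewrite /= sx.
apply: (IH) => x sx; apply: (IH) => y sy; exact/h/hst.
Qed.

(** * Entropy and variance of a symmetric boolean function of two copies *)

Definition mean_operator {R : realType} (L : (seq bool -> R) -> R) :=
  [/\ linearF L,
      forall f g, (forall x, f x <= g x) -> L f <= L g,
      forall c, L (fun=> c) = c &
      forall f : seq bool -> seq bool -> R,
        L (fun y => L (fun x => f x y)) = L (fun x => L (fun y => f x y))].

Lemma mean_operator_EX {R : realType} st (p : R) m j :
  shrinks st -> 0 <= p <= 1 -> mean_operator (EX st p m j).
Proof.
move=> hst hp; split.
- exact: linearF_EX.
- by move=> f g h; apply: EX_le => // x _; apply: h.
- exact: EX_cst.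
- by move=> f; apply: EX_comm; apply: linearF_EX.
Qed.

Definition cond {R : realType} (L : (seq bool -> R) -> R)
    (g : seq bool -> seq bool -> bool) (y : seq bool) : R :=
  L (fun x => (g x y)%:R).

Definition entropy {R : realType} (x : R) : R := - x * ln x.

(** Gibbs' inequality: if M is the mean of [g], the law of density [g / M] has both marginals of
    density [cond L g / M], and its relative entropy with respect to their product is
    non-negative. *)
Lemma entropy_subadd {R : realType} (L : (seq bool -> R) -> R)
    (g : seq bool -> seq bool -> bool) :
  mean_operator L -> (forall x y, g x y = g y x) ->
  entropy (L (cond L g)) <= 2 * L (fun y => entropy (cond L g y)).
Proof.
move=> [lin mono cst comm] gC.
pose a y := L (fun x => (g x y)%:R); rewrite (_ : cond L g = a) //; set M := L a.
have a01 y : 0 <= a y <= 1.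
  rewrite -{1}(cst 0) -[X in _ <= _ <= X](cst 1); apply/andP; split;
  by apply: (mono) => x; case: (g x y) => //=; rewrite ?ler01.
have M01 : 0 <= M <= 1.
  rewrite -{1}(cst 0) -[X in _ <= _ <= X](cst 1); apply/andP; split;
  by apply: (mono) => x; case/andP: (a01 x).
have ent0 y : 0 <= entropy (a y).
  have /andP[h0 h1] := a01 y; rewrite /entropy mulNr oppr_ge0 mulr_ge0_le0 //.
  exact: ln_le0.
have [M0|M0] := eqVneq M 0.
  rewrite {1}/entropy M0 oppr0 mul0r mulr_ge0 // -(cst 0); exact: mono.
have Mgt0 : 0 < M by rewrite lt_neqAle eq_sym M0; case/andP: M01.
have lnM0 : ln M <= 0 by apply: ln_le0; case/andP: M01.
pose h x := - ln (a x); pose z x : R := (a x == 0)%:R; pose C := 1 - ln M.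
(* [ln u <= u - 1] at [u = a x * a y / M]; since [ln 0 = 0], the points where [a]
   vanishes need the correction terms in [C], which have mean 0. *)
have pt x y : (g x y)%:R * (1 - ln M) + (- (a y / M) * a x
      + (- C * ((g x y)%:R * z x) + (- C * z y) * (g x y)%:R))
    <= (g x y)%:R * h x + h y * (g x y)%:R.
  have /andP[x0 x1] := a01 x; have /andP[y0 y1] := a01 y.
  have hx : 0 <= h x by rewrite oppr_ge0 ln_le0.
  have hy : 0 <= h y by rewrite oppr_ge0 ln_le0.
  have q : 0 <= a y / M * a x by rewrite !mulr_ge0 // invr_ge0 ltW.
  case: (g x y) => /=; last by rewrite !(mul0r, mulr0) !addr0; lra.
  rewrite /C !mul1r !mulr1 /z.
  have [ax|ax] := eqVneq (a x) 0; have [ay|ay] := eqVneq (a y) 0 => /=;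
    try by (rewrite ?mulr0 ?mulr1; lra).
  have px : 0 < a x by rewrite lt_neqAle eq_sym ax.
  have py : 0 < a y by rewrite lt_neqAle eq_sym ay.
  have pu : 0 < a y / M * a x by rewrite !mulr_gt0 ?invr_gt0.
  have := @le_ln1Dx R (a y / M * a x - 1); rewrite ltrBrDr addNr => /(_ pu).
  rewrite addrC subrK lnM ?posrE ?divr_gt0 // ln_div ?posrE // /h; lra.
have swap k : L (fun y => L (fun x => (g x y)%:R * k x)) = L (fun x => k x * a x).
  rewrite comm; congr L; apply/funext => x.
  rewrite -linearFZ //; congr L; apply/funext => y.
  by rewrite gC mulrC.
have pt2 y : (1 - ln M) * a y + (- 1 * a y
     + (- C) * L (fun x => (g x y)%:R * z x))
    <= L (fun x => (g x y)%:R * h x) + entropy (a y).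
  have := mono _ _ (pt^~ y).
  rewrite !linearFD // !linearFZ // -/(a y) -/M.
  rewrite (_ : (fun x => _ * (1 - ln M)) = (fun x => (1 - ln M) * (g x y)%:R));
    last by apply/funext => x; rewrite mulrC.
  rewrite linearFZ // -/(a y).
  have -> : - (a y / M) * M = - a y by rewrite mulNr divfK.
  have -> : - C * z y * a y = 0.
    by rewrite /z; have [->|_] := eqVneq (a y) 0; rewrite ?mulr0 ?mul0r.
  rewrite /entropy /h; lra.
have := mono _ _ pt2.
rewrite !linearFD // !linearFZ // !swap -/M.
rewrite (_ : (fun x => z x * a x) = (fun=> 0)); last first.
  by apply/funext => x; rewrite /z; have [->|_] := eqVneq (a x) 0; rewrite ?mulr0 ?mul0r.
rewrite cst (_ : (fun x => h x * a x) = (fun y => entropy (a y))); last first.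
  by apply/funext => x; rewrite /h /entropy; ring.
by rewrite [entropy M]/entropy; lra.
Qed.

(* Quantifies that the second-order Hoeffding component of a boolean function
   cannot vanish, which improves on the Efron-Stein inequality. *)
Lemma variance_gain {R : realType} (L : (seq bool -> R) -> R)
    (g : seq bool -> seq bool -> bool) :
  mean_operator L -> (forall x y, g x y = g y x) ->
  L (cond L g) * (1 - L (cond L g))
    + (L (cond L g) * (1 - L (cond L g))) ^+ 2 / 9
  <= 2 * L (fun y => cond L g y * (1 - cond L g y)).
Proof.
move=> [lin mono cst comm] gC.
pose a y := L (fun x => (g x y)%:R); rewrite (_ : cond L g = a) //; set M := L a.
set v := M * (1 - M).
have a01 y : 0 <= a y <= 1.
  rewrite -{1}(cst 0) -[X in _ <= _ <= X](cst 1); apply/andP; split;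
  by apply: (mono) => x; case: (g x y) => //=; rewrite ?ler01.
have M01 : 0 <= M <= 1.
  rewrite -{1}(cst 0) -[X in _ <= _ <= X](cst 1); apply/andP; split;
  by apply: (mono) => x; case/andP: (a01 x).
pose A2 := L (fun y => a y * a y).
pose U := L (fun y => L (fun z => `|a y - a z|)).
have Ea : L (fun y => a y * (1 - a y)) = M - A2.
  rewrite -linearFB //; congr L; apply/funext => y; ring.
(* [|a y - a z|] is at most the mean over [w] of the indicator that [g w y] and [g w z] differ. *)
have U1 : U <= 2 * (M - A2).
  have e : 2 * (M - A2) = L (fun y => L (fun z => a y + a z
             + (-2) * L (fun w => (g w y)%:R * (g w z)%:R))).
    transitivity (L (fun y => a y + (M + (-2) * L (fun w => a w * (g w y)%:R)))).
      rewrite !linearFD // linearFZ // cst -/M.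
      have -> : L (fun y => L (fun w => a w * (g w y)%:R)) = A2.
        rewrite comm; congr L; apply/funext => w.
        rewrite linearFZ //; congr (_ * L _); apply/funext => y; by rewrite gC.
      ring.
    congr L; apply/funext => y.
    rewrite !linearFD // cst linearFZ // comm -/M addrA; congr (_ + _ * L _).
    apply/funext => w; rewrite linearFZ // mulrC; congr (_ * L _).
    by apply/funext => z; rewrite gC.
  rewrite e; apply: (mono) => y; apply: (mono) => z.
  have -> : a y + a z + (-2) * L (fun w => (g w y)%:R * (g w z)%:R)
     = L (fun w => (g w y)%:R + (g w z)%:R + (-2) * ((g w y)%:R * (g w z)%:R)).
    by rewrite !linearFD // linearFZ.
  rewrite /a -linearFB // ler_norml.
  rewrite -[X in X <= _]mulN1r -(linearFZ (-1)) //.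
  apply/andP; split; apply: (mono) => w; case: (g w y); case: (g w z) => /=; lra.
have S : L (fun y => L (fun z => (a y - a z) ^+ 2)) = 2 * (A2 - M ^+ 2).
  transitivity (L (fun y => a y * a y + ((-2 * M) * a y + A2))).
    congr L; apply/funext => y.
    rewrite (_ : (fun z => _) = (fun z => a y * a y + (-2 * a y * a z + a z * a z))).
      by rewrite !linearFD // cst (linearFZ (-2 * a y)) // -/M -/A2; ring.
    by apply/funext => z; ring.
  rewrite !linearFD // linearFZ // cst -/M -/A2; ring.
have US : 2 * (A2 - M ^+ 2) <= U.
  rewrite -S; apply: (mono) => y; apply: (mono) => z.
  have := a01 y; have := a01 z; case: (lerP (a z) (a y)) => h h1 h2.
    by nra.
  by nra.
have tri y : U <= 2 * L (fun z => `|a y - a z|).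
  have -> : 2 * L (fun z => `|a y - a z|)
    = L (fun w => L (fun z => `|a y - a w| + `|a y - a z|)).
    transitivity (L (fun w => `|a y - a w| + L (fun z => `|a y - a z|))).
      by rewrite [RHS]linearFD // cst; ring.
    by congr L; apply/funext => w; rewrite linearFD // cst.
  apply: (mono) => w; apply: (mono) => z.
  rewrite (_ : a w - a z = - (a y - a w) + (a y - a z)); last by ring.
  by rewrite (le_trans (ler_normD _ _)) // normrN.
(* With d = [|a y - a z|], 1 - d is at least [a y] or at least [1 - a y], hence at least their
   product. Multiply by d and average; [tri] replaces the inner mean of d by [U / 2]. *)
have key : (M - A2) * (U / 2) <= U - 2 * (A2 - M ^+ 2).
  rewrite -S -Ea mulrC -linearFZ // -linearFB //; apply: (mono) => y.
  apply: le_trans (_ : a y * (1 - a y) * L (fun z => `|a y - a z|) <= _).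
    have t0 : 0 <= a y * (1 - a y) by have := a01 y; nra.
    by rewrite mulrC ler_wpM2l //; have := tri y; lra.
  rewrite -linearFZ // -linearFB //; apply: (mono) => z.
  have /andP[y0 y1] := a01 y; have /andP[z0 z1] := a01 z.
  case: (lerP (a z) (a y)) => h.
    have : 0 <= (a y - a z) * (1 - (a y - a z) - a y * (1 - a y)) by apply: mulr_ge0; nra.
    by lra.
  have : 0 <= (a z - a y) * (1 - (a z - a y) - a y * (1 - a y)) by apply: mulr_ge0; nra.
  by lra.
rewrite Ea.
have hv : v = M - M ^+ 2 by rewrite /v; ring.
have v14 : v <= 1 / 4.
  by rewrite hv; have := sqr_ge0 (M - 1 / 2); lra.
have v0 : 0 <= v by apply: mulr_ge0; lra.
(* [eta] is the squared norm of the second-order Hoeffding component: [v] minus twice the variance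
   of [a]. By [US] and [U1], [U] lies between [v - eta] and [v + eta]. *)
pose eta := 2 * (M - A2) - v.
have eta0 : 0 <= eta by rewrite /eta; lra.
have M2 : M - A2 = (v + eta) / 2 by rewrite /eta; lra.
have A2M : A2 - M ^+ 2 = (v - eta) / 2 by rewrite /eta; lra.
rewrite M2 A2M in key U1 US *.
have k2 : v ^+ 2 - eta ^+ 2 <= 8 * eta.
  have : (v + eta) * (v - eta) <= (v + eta) * U by rewrite ler_wpM2l; lra.
  by nra.
rewrite leNgt; apply/negP => hlt.
have h9 : eta < v ^+ 2 / 9 by lra.
have : v ^+ 2 <= v / 4 by nra.
have : eta ^+ 2 <= eta * (v ^+ 2 / 9) by rewrite expr2 ler_wpM2l // ltW.
by nra.
Qed.

(** * Derivatives of the means in the parameter, built by the product rule *)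

Fixpoint DB {R : realType} (p : R) (j : nat) (f : seq bool -> R) : R :=
  if j is j'.+1
  then EB p j' (fun x => f (true :: x)) - EB p j' (fun x => f (false :: x))
       + (p * DB p j' (fun x => f (true :: x))
          + (1 - p) * DB p j' (fun x => f (false :: x)))
  else 0.

Fixpoint DX {R : realType} (p : R) (m j : nat) (f : seq bool -> R) : R :=
  if m is m'.+1
  then DX p m' j.+1 (fun x => EX stepA p m' j.+1 (fun y => f (stepA x y)))
       + EX stepA p m' j.+1 (fun x => DX p m' j.+1 (fun y => f (stepA x y)))
  else DB p j f.

Lemma linearF_DB {R : realType} (p : R) j : linearF (DB p j).
Proof.
elim: j => [|j IH] a f g /=; first by ring.
by rewrite !IH !linearF_EB; ring.
Qed.

Lemma linearF_DX {R : realType} (p : R) m j : linearF (DX p m j).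
Proof.
elim: m j => [|m IH] j a f g /=; first exact: linearF_DB.
have -> : (fun x => EX stepA p m j.+1 (fun y => a * f (stepA x y) + g (stepA x y)))
  = (fun x => a * EX stepA p m j.+1 (fun y => f (stepA x y))
       + EX stepA p m j.+1 (fun y => g (stepA x y))).
  by apply/funext => x; rewrite -linearF_EX.
have -> : (fun x => DX p m j.+1 (fun y => a * f (stepA x y) + g (stepA x y)))
  = (fun x => a * DX p m j.+1 (fun y => f (stepA x y))
       + DX p m j.+1 (fun y => g (stepA x y))).
  by apply/funext => x; rewrite -IH.
by rewrite IH linearF_EX; ring.
Qed.

(** The step is symmetric, so both terms of the product rule agree. The factor 2 is that of
    [entropy_subadd] and [variance_gain], which lets lower bounds pass from one step to the next. *)
Lemma DXS {R : realType} (p : R) m j f :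
  DX p m.+1 j f
  = 2 * EX stepA p m j.+1 (fun y => DX p m j.+1 (fun x => f (stepA x y))).
Proof.
rewrite /= (EX_comm _ _ _ _ _ (linearF_DX p m j.+1)) mulr_natl mulr2n.
congr (_ + _); congr EX; apply/funext => y; congr DX; apply/funext => x.
by rewrite stepAC.
Qed.

(** The integrand may itself depend on the parameter, because in [EX] the outer mean is applied to
    an inner mean that does. *)
Lemma is_derive_EB {R : realType} (p : R) j (f : R -> seq bool -> R) df :
  (forall x, is_derive p 1 (fun q => f q x) (df x)) ->
  is_derive p 1 (fun q => EB q j (f q)) (DB p j (f p) + EB p j df).
Proof.
elim: j f df => [|j IH] f df h /=; first by rewrite add0r.
have ht := IH (fun q x => f q (true :: x)) (fun x => df (true :: x)) (fun x => h _).
have hf := IH (fun q x => f q (false :: x)) (fun x => df (false :: x)) (fun x => h _).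
have h1 : is_derive p 1 (fun q : R => 1 - q) (-1).
  apply: is_derive_eq (is_deriveB (is_derive_cst (1 : R) p 1) (is_derive_id p 1)) _.
  by rewrite sub0r.
apply: is_derive_eq (is_deriveD (is_deriveM (is_derive_id p 1) ht)
                                (is_deriveM h1 hf)) _.
rewrite /GRing.scale /=; ring.
Qed.

Lemma is_derive_EX {R : realType} (p : R) m j (f : R -> seq bool -> R) df :
  (forall x, is_derive p 1 (fun q => f q x) (df x)) ->
  is_derive p 1 (fun q => EX stepA q m j (f q)) (DX p m j (f p) + EX stepA p m j df).
Proof.
elim: m j f df => [|m IH] j f df h /=; first exact: is_derive_EB.
apply: is_derive_eq (IH j.+1 (fun q x => EX stepA q m j.+1 (fun y => f q (stepA x y)))
  _ (fun x => IH j.+1 (fun q y => f q (stepA x y)) _ (fun y => h _))) _.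
by rewrite linearFD ?addrA //; apply: linearF_EX.
Qed.

(** * Entropy bounds on the derivative of a monotone event *)

Definition increasing (j : nat) (F : seq bool -> bool) :=
  forall x y, size x = j -> size y = j ->
    (forall k, nth false x k -> nth false y k) -> F x -> F y.

Lemma nth_orN x k :
  nth false (orN x) k = (k.+1 < size x)%N && (nth false x k || nth false x k.+1).
Proof.
elim: x k => [|a [|b x] IH] k; [by rewrite nth_nil|by case: k => [|k]; rewrite /= ?nth_nil|].
by case: k => [//|k]; rewrite orN_cons /= IH.
Qed.

Lemma nth_andS x y k : nth false (andS x y) k = nth false x k && nth false y k.
Proof.
elim: x y k => [|a x IH] [|b y] [|k] //=; rewrite ?andbF //.
exact: IH.
Qed.

Lemma increasing_stepA j F y : increasing j F -> size y = j.+1 ->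
  increasing j.+1 (fun x => F (stepA x y)).
Proof.
move=> hF sy x x' sx sx' le; apply: hF; rewrite ?(@size_stepA j) // => k.
rewrite !nth_andS !nth_orN sx sx' => /andP[/andP[-> /orP h] ->]; rewrite andbT /=.
by apply/orP; case: h => h; [left|right]; exact: le.
Qed.

(** This is ln u <= u - 1 at u = [x / M], multiplied by [x]; it is an equality at [x = M]. *)
Lemma entropy_tangent {R : realType} (x M : R) : 0 <= x -> 0 < M ->
  x * (1 - ln M) - x ^+ 2 / M <= entropy x.
Proof.
rewrite le_eqVlt => /orP[/eqP<-|x0] M0.
  by rewrite /entropy oppr0 !mul0r expr0n /= mul0r subr0.
have xM : 0 < x / M by rewrite divr_gt0.
have := @le_ln1Dx R (x / M - 1); rewrite ltrBrDr addNr => /(_ xM).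
rewrite addrC subrK ln_div ?posrE // => h.
have : x * (ln x - ln M) <= x * (x / M - 1) by rewrite ler_wpM2l // ltW.
by rewrite /entropy; lra.
Qed.

Lemma entropy_ge0 {R : realType} (x : R) : 0 <= x <= 1 -> 0 <= entropy x.
Proof.
by case/andP=> h0 h1; rewrite /entropy mulNr oppr_ge0 mulr_ge0_le0 // ln_le0.
Qed.

(** Use [entropy_tangent] at the mean for both [a] and [b]. The loss is p(1-p)(a-b)^2 divided by the
    mean, and the mean is at least p(a-b). *)
Lemma entropy_bernoulli {R : realType} (p a b : R) :
  0 <= p <= 1 -> 0 <= b -> b <= a -> a <= 1 ->
  entropy (p * a + (1 - p) * b) <= a - b + (p * entropy a + (1 - p) * entropy b).
Proof.
move=> hp b0 ba a1; set M := p * a + _.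
have M0 : 0 <= M by rewrite /M addr_ge0 // mulr_ge0; lra.
have [MZ|MN] := eqVneq M 0.
  have ea : 0 <= p * entropy a by rewrite mulr_ge0 ?entropy_ge0; lra.
  have eb : 0 <= (1 - p) * entropy b by rewrite mulr_ge0 ?entropy_ge0; lra.
  by rewrite {1}/entropy MZ oppr0 mul0r; lra.
have Mp : 0 < M by rewrite lt_neqAle eq_sym MN.
have a0 : 0 <= a by lra.
have ha : p * (a * (1 - ln M) - a ^+ 2 / M) <= p * entropy a.
  by rewrite ler_wpM2l ?entropy_tangent //; lra.
have hb : (1 - p) * (b * (1 - ln M) - b ^+ 2 / M) <= (1 - p) * entropy b.
  by rewrite ler_wpM2l ?entropy_tangent //; lra.
have e : p * a ^+ 2 + (1 - p) * b ^+ 2 - M ^+ 2 = p * (1 - p) * (a - b) ^+ 2.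
  by rewrite /M; ring.
have q : (p * a ^+ 2 + (1 - p) * b ^+ 2 - M ^+ 2) / M <= a - b.
  rewrite e ler_pdivrMr // expr2.
  have : p * (a - b) <= M.
    have : 0 <= p * b by apply: mulr_ge0; lra.
    have : 0 <= (1 - p) * b by apply: mulr_ge0; lra.
    by rewrite /M; lra.
  have : 0 <= (a - b) * (p * (p * (a - b))) by rewrite !mulr_ge0; lra.
  move=> h1 /(ler_wpM2l (_ : 0 <= a - b)); rewrite subr_ge0 => /(_ ba) h2.
  by lra.
have e2 : (p * a ^+ 2 + (1 - p) * b ^+ 2 - M ^+ 2) / M
   = p * (a ^+ 2 / M) + (1 - p) * (b ^+ 2 / M) - M by field.
have e3 : entropy M = p * (a * (1 - ln M)) + (1 - p) * (b * (1 - ln M)) - M.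
  by rewrite /entropy /M; ring.
rewrite e2 in q; rewrite e3; lra.
Qed.

Lemma EX_indic {R : realType} st (p : R) m j (F : seq bool -> bool) :
  shrinks st -> 0 <= p <= 1 -> 0 <= EX st p m j (fun x => (F x)%:R) <= 1.
Proof.
move=> hst hp; rewrite -{1}(EX_cst st p m j 0) -[X in _ <= _ <= X](EX_cst st p m j 1).
by apply/andP; split; apply: EX_le => // x _; case: (F x) => //=; rewrite ler01.
Qed.

(** Induction on the bits: the influence of the first bit is the term [a - b] of
    [entropy_bernoulli]. The bound for [1 - M] is the same inequality with [p] and [1 - p]
    exchanged. *)
Lemma DB_entropy {R : realType} (p : R) j F : 0 <= p <= 1 -> increasing j F ->
  let M := EB p j (fun x => (F x)%:R) in
  (entropy M <= DB p j (fun x => (F x)%:R))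
  /\ (entropy (1 - M) <= DB p j (fun x => (F x)%:R)).
Proof.
move=> hp; elim: j F => [|j IH] F hF /=.
  by case: (F [::]); rewrite /= ?subrr ?subr0 /entropy ln1 ?mulr0 ?oppr0 ?mul0r.
have hc c : increasing j (fun x => F (c :: x)).
  move=> x y sx sy h; apply: hF; rewrite /= ?sx ?sy // => -[|k] //=; exact: h.
have [t1 t2] := IH _ (hc true); have [f1 f2] := IH _ (hc false).
have := EX_indic 0 j (fun x => F (true :: x)) shrinks_stepA hp.
have := EX_indic 0 j (fun x => F (false :: x)) shrinks_stepA hp.
rewrite /=; set a := EB p j (fun x => (F (true :: x))%:R) in t1 t2 *.
set b := EB p j (fun x => (F (false :: x))%:R) in f1 f2 *.
move=> /andP[b0 b1] /andP[a0 a1].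
have ba : b <= a.
  apply: EB_le => // x sx; have := @hF (false :: x) (true :: x).
  rewrite /= sx => /(_ erefl erefl).
  case: (F (false :: x)) => [->//|_]; last by case: (F _); rewrite ?ler01.
  by case.
have hq : 0 <= 1 - p <= 1 by lra.
have T1 : p * entropy a <= p * DB p j (fun x => (F (true :: x))%:R).
  by rewrite ler_wpM2l //; lra.
have T2 : p * entropy (1 - a) <= p * DB p j (fun x => (F (true :: x))%:R).
  by rewrite ler_wpM2l //; lra.
have T3 : (1 - p) * entropy b <= (1 - p) * DB p j (fun x => (F (false :: x))%:R).
  by rewrite ler_wpM2l //; lra.
have T4 : (1 - p) * entropy (1 - b) <= (1 - p) * DB p j (fun x => (F (false :: x))%:R).
  by rewrite ler_wpM2l //; lra.
split; first by have := entropy_bernoulli hp b0 ba a1; lra.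
have := @entropy_bernoulli R (1 - p) (1 - b) (1 - a) hq.
rewrite subr_ge0 => /(_ a1); rewrite lerD2l lerN2 => /(_ ba).
rewrite gerBl => /(_ b0).
rewrite (_ : (1 - p) * (1 - b) + (1 - (1 - p)) * (1 - a) = 1 - (p * a + (1 - p) * b));
  [by lra | by ring].
Qed.

Definition PrA {R : realType} (p : R) (m j : nat) (F : seq bool -> bool) : R :=
  EX stepA p m j (fun x => (F x)%:R).

Lemma EXS_cond {R : realType} (p : R) m j (F : seq bool -> bool) :
  PrA p m.+1 j F
  = EX stepA p m j.+1 (cond (EX stepA p m j.+1) (fun x y => F (stepA x y))).
Proof.
rewrite /PrA /=; congr EX; apply/funext => x; congr EX; apply/funext => y.
by rewrite stepAC.
Qed.

Lemma PrA_itv {R : realType} (p : R) m j F : 0 <= p <= 1 -> 0 <= PrA p m j F <= 1.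
Proof. exact/EX_indic/shrinks_stepA. Qed.

Lemma DX_entropy {R : realType} (p : R) m j F : 0 <= p <= 1 -> increasing j F ->
  entropy (PrA p m j F) <= DX p m j (fun x => (F x)%:R)
  /\ entropy (1 - PrA p m j F) <= DX p m j (fun x => (F x)%:R).
Proof.
move=> hp; elim: m j F => [|m IH] j F hF; first exact: DB_entropy.
rewrite EXS_cond DXS; set L := EX stepA p m j.+1.
pose g x y := F (stepA x y).
have gC x y : g x y = g y x by rewrite /g stepAC.
have hL : mean_operator L by apply: mean_operator_EX => //; exact: shrinks_stepA.
have e2 : cond L (fun x y => ~~ g x y) = (fun y => 1 - cond L g y).
  apply/funext => y; rewrite /cond -[X in X - _](EX_cst stepA p m j.+1).
  rewrite -linearFB; last exact: linearF_EX.
  by congr EX; apply/funext => x; case: (g x y); rewrite /= ?subrr ?subr0.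
split; last first.
  have := @entropy_subadd R L (fun x y => ~~ g x y) hL (fun x y => congr1 negb (gC x y)).
  rewrite e2 (_ : L (fun y => 1 - _) = 1 - L (cond L g)); last first.
    rewrite -[X in X - _](EX_cst stepA p m j.+1) -linearFB //; exact: linearF_EX.
  move/le_trans; apply; rewrite ler_pM2l //; apply: EX_le => // [|y sy].
    exact: shrinks_stepA.
  by have [_] := IH _ _ (increasing_stepA hF sy).
apply: (le_trans (entropy_subadd hL gC)).
rewrite ler_pM2l //; apply: EX_le => // [|y sy]; first exact: shrinks_stepA.
by have [] := IH _ _ (increasing_stepA hF sy).
Qed.

(** * Sharpness: derivative against variance *)

Lemma entropy_max_ge {R : realType} (t : R) : 1 <= t ->
  exists2 C : R, 0 < C & forall x D : R, 0 <= x <= 1 ->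
    entropy x <= D -> entropy (1 - x) <= D ->
    t * (x * (1 - x)) - C * (x * (1 - x)) ^+ 2 <= D.
Proof.
(* For x <= e^(-t) the logarithm alone gives [t * x <= entropy x]. For x between e^(-t) and 1/2,
   x(1-x) >= e^(-t)/2 and this [C] makes the left side non-positive. The rest follows by x -> 1 -
   x. *)
move=> t1; pose C := 2 * t * expR t.
have C0 : 0 < C by rewrite !mulr_gt0 ?expR_gt0 //; lra.
exists C => //.
have half x : 0 <= x -> x <= 1 / 2 ->
    t * (x * (1 - x)) - C * (x * (1 - x)) ^+ 2 <= entropy x.
  move=> x0 x12; set v := x * (1 - x).
  have v0 : 0 <= v by apply: mulr_ge0; lra.
  have vx : v <= x by rewrite /v; nra.
  have [xs|xl] := lerP x (expR (- t)).
    have tx : t * x <= entropy x.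
      move: x0; rewrite le_eqVlt => /orP[/eqP<-|x0].
        by rewrite /entropy mulr0 oppr0 mul0r.
      have : ln x <= - t by rewrite -[- t]expRK ler_ln ?posrE ?expR_gt0.
      move/(ler_wpM2l (ltW x0)); rewrite /entropy; lra.
    have : t * v <= t * x by rewrite ler_wpM2l //; lra.
    have : 0 <= C * v ^+ 2 by rewrite mulr_ge0 ?sqr_ge0 // ltW.
    by lra.
  have e0 : 0 <= entropy x by apply: entropy_ge0; lra.
  apply: le_trans e0; rewrite subr_le0 expr2 [C * _]mulrA ler_wpM2r //.
  have xv : x / 2 <= v by rewrite /v; nra.
  have : expR t * expR (- t) <= expR t * (2 * v).
    by rewrite ler_wpM2l ?expR_ge0 //; lra.
  rewrite -expRD subrr expR0 => h.
  have : t * 1 <= t * (expR t * (2 * v)) by rewrite ler_wpM2l //; lra.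
  by rewrite /C; lra.
move=> x D hx h1 h2; have [xh|xh] := lerP x (1 / 2).
  by apply: le_trans h1; apply: half => //; case/andP: hx.
apply: le_trans h2; rewrite (_ : x * (1 - x) = (1 - x) * (1 - (1 - x))); last by ring.
by apply: half; lra.
Qed.

Lemma DX_variance {R : realType} (t : R) : 1 <= t ->
  exists m0, forall m, (m0 <= m)%N -> forall (p : R) j F, 0 <= p <= 1 ->
    increasing j F ->
    t / 2 * (PrA p m j F * (1 - PrA p m j F)) <= DX p m j (fun x => (F x)%:R).
Proof.
move=> t1; have [C C0 hC] := entropy_max_ge t1.
(* [s] solves 1 - s = 9sC. In the average of the two bounds with weights [1 - s] and [s], the gain
   v^2/9 then pays for the loss C v^2, as [lam m] is at least 1. *)
pose s := (9 * C + 1)^-1.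
have D0 : 0 < 9 * C + 1 by lra.
have s0 : 0 < s by rewrite invr_gt0.
have s1 : s < 1 by rewrite invf_lt1 //; lra.
have sC : (1 - s) = 9 * (s * C).
  have : s * (9 * C + 1) = 1 by rewrite mulVf // gt_eqF.
  by lra.
(* The solution of [lam m.+1 = (1 - s) * lam m + s * t] with [lam 0 = 1]; it tends to [t]. *)
pose lam m := t - (t - 1) * (1 - s) ^+ m.
have lam1 m : 1 <= lam m.
  have : (1 - s) ^+ m <= 1 by rewrite exprn_ile1; lra.
  move/(ler_wpM2l (_ : 0 <= t - 1)); rewrite subr_ge0 => /(_ t1).
  by rewrite /lam; lra.
have bound m : forall (p : R) j F, 0 <= p <= 1 -> increasing j F ->
    lam m * (PrA p m j F * (1 - PrA p m j F)) <= DX p m j (fun x => (F x)%:R).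
  elim: m => [|m IH] p j F hp hF; set M := PrA _ _ _ _.
    have [h _] := DX_entropy 0 hp hF; apply: le_trans h.
    have := PrA_itv 0 j F hp; rewrite -/M => /andP[M0 _].
    have := entropy_tangent M0 ltr01; rewrite ln1 divr1 /lam expr0; lra.
  have hM := PrA_itv m.+1 j F hp; rewrite -/M in hM.
  have [h1 h2] := DX_entropy m.+1 hp hF; rewrite -/M in h1 h2.
  have low := hC _ _ hM h1 h2.
  pose L := EX stepA p m j.+1; pose g x y := F (stepA x y).
  have hL : mean_operator L by apply: mean_operator_EX => //; exact: shrinks_stepA.
  have gC x y : g x y = g y x by rewrite /g stepAC.
  have := variance_gain hL gC.
  rewrite (_ : L (cond L g) = M); last by rewrite /M EXS_cond.
  set v := M * (1 - M) in low * => gain.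
  have v0 : 0 <= v by apply: mulr_ge0; lra.
  have up : lam m * (v + v ^+ 2 / 9) <= DX p m.+1 j (fun x => (F x)%:R).
    apply: (@le_trans _ _ (lam m * (2 * L (fun y => cond L g y * (1 - cond L g y))))).
      by rewrite ler_wpM2l //; have := lam1 m; lra.
    rewrite DXS mulrCA ler_pM2l // -linearFZ; last exact: linearF_EX.
    apply: EX_le => // [|y sy]; first exact: shrinks_stepA.
    exact: (IH p j.+1 _ hp (increasing_stepA hF sy)).
  have -> : lam m.+1 = (1 - s) * lam m + s * t by rewrite /lam exprS; ring.
  have c1 : (1 - s) * (lam m * (v + v ^+ 2 / 9))
      <= (1 - s) * DX p m.+1 j (fun x => (F x)%:R) by rewrite ler_wpM2l //; lra.
  have c2 : s * (t * v - C * v ^+ 2) <= s * DX p m.+1 j (fun x => (F x)%:R).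
    by rewrite ler_wpM2l //; lra.
  have c3 : 0 <= s * C * v ^+ 2 * (lam m - 1).
    rewrite !mulr_ge0 ?sqr_ge0 ?subr_ge0 //; lra.
  have c4 : (1 - s) * (lam m * (v ^+ 2 / 9)) = s * C * v ^+ 2 * lam m.
    by rewrite sC; field.
  lra.
have z1 : `|1 - s| < 1 by rewrite ger0_norm; lra.
have h12 : 0 < 1 / 2 :> R by lra.
have cv : (fun n => (1 - s) ^+ n) @ \oo --> (0 : R).
  exact: (@cvg_expr R (1 - s) z1).
move/cvgrPdist_lt: cv => cv; have [m0 _ hm0] := cv _ h12.
exists m0 => m hm p j F hp hF.
apply: le_trans (bound m p j F hp hF); rewrite ler_wpM2r //.
  have /andP[M0 M1] : 0 <= PrA p m j F <= 1 := PrA_itv m j F hp.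
  by apply: mulr_ge0; lra.
have := hm0 m hm; rewrite sub0r normrN ger0_norm; last by apply: exprn_ge0; lra.
move=> /ltW h; have : (t - 1) * (1 - s) ^+ m <= (t - 1) * (1 / 2).
  by rewrite ler_wpM2l // subr_ge0.
by rewrite /lam; lra.
Qed.

(** * Runs of lost positions, and survival at p = 7/8 *)

(* [run_event B x]: all positions of [B] are lost for Bob in [x], and the position
   just after each maximal run of [B] (if there is one) is won by him. *)
Fixpoint run_event (B x : seq bool) : bool :=
  if B is b :: B'
  then [&& b ==> ~~ head false x,
           b && ~~ head true B' ==> head false (behead x)
         & run_event B' (behead x)]
  else true.

(* Weight [c] per position and [K] per maximal run; [prev] tells whether the
   position preceding [B] belongs to the set. *)
Fixpoint run_weight {R : realType} (K c : R) (prev : bool) (B : seq bool) : R :=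
  if B is b :: B'
  then (if b then (if prev then c else c * K) else 1) * run_weight K c b B'
  else 1.

(* The weight of [B + {0, 1}], provided the runs of [B] remain disjoint. *)
Fixpoint dil_weight {R : realType} (K c : R) (prev : bool) (B : seq bool) : R :=
  if B is b :: B'
  then (if b then (if prev then c else c * (c * K)) else 1) * dil_weight K c b B'
  else 1.

(** The set A + {0, 1}, since a lost bit of [orN x] means two adjacent lost bits of [x]. [prev]
    carries the element just before [A]. *)
Fixpoint dilate (prev : bool) (A : seq bool) : seq bool :=
  if A is a :: A' then (prev || a) :: dilate a A' else [:: prev].

(** Excludes the pattern 1, 0, 1, so that dilation lengthens each run by one without merging any. *)
Fixpoint gap_free (A : seq bool) : bool :=
  if A is a :: A'
  then ~~ (a && ~~ head true A' && head false (behead A')) && gap_free A'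
  else true.

(** Charges each position of [B], lost in an AND, to one of the two copies. *)
Fixpoint splits (B : seq bool) : seq (seq bool * seq bool) :=
  match B with
  | [::] => [:: ([::], [::])]
  | true :: B' => [seq (true :: u.1, false :: u.2) | u <- splits B']
                  ++ [seq (false :: u.1, true :: u.2) | u <- splits B']
  | false :: B' => [seq (false :: u.1, false :: u.2) | u <- splits B']
  end.

Lemma size_splits B u : u \in splits B -> size u.1 = size B /\ size u.2 = size B.
Proof.
elim: B u => [|[] B IH] u /=; first by rewrite inE => /eqP ->.
  by rewrite mem_cat => /orP[] /mapP[w /IH[h1 h2] ->]; rewrite /= h1 h2.
by move=> /mapP[w /IH[h1 h2] ->]; rewrite /= h1 h2.
Qed.

(** Right-maximality is inherited: the position after a run is won in [orN x] while its left bit in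
    [x] is lost, so its right bit is won and stops the dilated run. *)
Lemma run_event_dilate A x (prev : bool) : size x = (size A).+1 ->
  run_event A (orN x) ->
  (prev -> ~~ head false x /\ (~~ head true A -> head false (orN x))) ->
  run_event (dilate prev A) x.
Proof.
elim: A x prev => [|a A IH] [|x0 x] prev //=.
  by move=> _ _; case: prev => //= /(_ isT)[->].
case: x IH => [//|x1 x] IH [sx] /=.
move=> /and3P[ha hs hr] hp.
have rec : run_event (dilate a A) (x1 :: x).
  apply: IH => //=; first by rewrite sx.
  move=> aT; move: ha hs; rewrite aT /= negb_or => /andP[_ ->] hs; split => //.
  by move=> hA; move: hs; rewrite hA.
rewrite rec andbT; apply/andP; split.
  apply/implyP => /orP[/hp[]//|aT].
  by move: ha; rewrite aT /= negb_or => /andP[].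
apply/implyP => /andP[pa hd].
have aF : a = false by apply/negbTE; move: hd; case: (A) => [|b A'] //=; case: a {ha hs hp rec pa}.
move: pa; rewrite aF orbF => /hp[]; rewrite aF /= => /negbTE -> h.
exact: h.
Qed.

(** In a pattern 1, 0, 1 the middle position of [orN x] must be won, yet its two neighbours force
    both of its bits in [x] to be lost. *)
Lemma run_event_gap A x : size x = (size A).+1 ->
  run_event A (orN x) -> gap_free A.
Proof.
elim: A x => [//|a A IH] [|x0 [|x1 x]] // [sx].
rewrite orN_cons [run_event _ _]/= => /and3P[ha hs hr].
rewrite /= (IH (x1 :: x)) ?andbT //=; last by rewrite sx.
apply/negP => /andP[/andP[aT hA] hA2].
move: ha hs; rewrite aT hA /= negb_or => /andP[_ x1F].
case: A sx hr hA hA2 {IH} => [//|[] [|[] A]] //=.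
case: x => [|x2 [|x3 x]] //= _ /and3P[h _ _] _ _.
by rewrite (negbTE x1F) /=; move: h; rewrite negb_or => /andP[/negbTE ->].
Qed.

(** The three claims are the states of the induction: outside the dilated runs, just after one, and
    inside a run of [A], where the factor [c] of the added position is still to come. *)
Lemma run_weight_dilate {R : realType} (K c : R) A : gap_free A ->
  [/\ run_weight K c false (dilate false A) = dil_weight K c false A,
      ~~ head false A ->
        run_weight K c true (dilate false A) = dil_weight K c false A &
      ~~ (~~ head true A && head false (behead A)) ->
        run_weight K c true (dilate true A) = c * dil_weight K c true A].
Proof.
elim: A => [|a A IH] /=; first by rewrite !mulr1.
move=> /andP[hg /IH[h00 h10 h11]]; case: a hg => /= hg.
  by rewrite h11 //; split => //; ring.
rewrite h00; split=> // hA; rewrite h10 //; ring.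
Qed.

Definition rsplits {R : realType} (K c : R) (pA pA' : bool) (B : seq bool) : R :=
  \sum_(u <- splits B) dil_weight K c pA u.1 * dil_weight K c pA' u.2.

Lemma rsplits_cons {R : realType} (K c : R) pA pA' b B :
  rsplits K c pA pA' (b :: B) =
  if b then (if pA then c else c * (c * K)) * rsplits K c true false B
            + (if pA' then c else c * (c * K)) * rsplits K c false true B
  else rsplits K c false false B.
Proof.
rewrite /rsplits; case: b => /=; last first.
  by rewrite big_map; apply: eq_bigr => u _ /=; rewrite !mul1r.
rewrite big_cat !big_map /= !big_distrr /=; congr (_ + _);
  by apply: eq_bigr => u _; rewrite mul1r; ring.
Qed.

Lemma run_weight_ge0 {R : realType} (K c : R) prev B :
  0 <= K -> 0 <= c -> 0 <= run_weight K c prev B.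
Proof.
move=> K0 c0; elim: B prev => [|b B IH] prev //=; rewrite mulr_ge0 //.
by case: b; case: prev; rewrite ?mulr_ge0.
Qed.

Lemma dil_weight_ge0 {R : realType} (K c : R) prev B :
  0 <= K -> 0 <= c -> 0 <= dil_weight K c prev B.
Proof.
move=> K0 c0; elim: B prev => [|b B IH] prev //=; rewrite mulr_ge0 //.
by case: b; case: prev; rewrite ?mulr_ge0.
Qed.

(** A run of [B] starts in either copy, at cost 2c(cK) <= c'K'. Inside it, one stays in the same
    copy at cost c or starts a run in the other at cost c(cK), in total at most c'. *)
Lemma rsplits_le {R : realType} (K c K' c' : R) B :
  0 <= K -> 0 <= c -> 2 * c * K <= K' -> c * (1 + c * K) <= c' ->
  [/\ rsplits K c false false B <= run_weight K' c' false B,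
      rsplits K c true false B <= run_weight K' c' true B &
      rsplits K c false true B <= run_weight K' c' true B].
Proof.
move=> K0 c0 hK hc.
have cK : 0 <= c * K by rewrite mulr_ge0.
have cc : c <= c' by have : 0 <= c * (c * K) by [rewrite mulr_ge0]; lra.
have c'0 : 0 <= c' by lra.
have K'0 : 0 <= K' by lra.
elim: B => [|b B [h1 h2 h3]].
  by rewrite /rsplits !big_seq1 /= !mulr1.
rewrite !rsplits_cons; case: b => /=; last by rewrite mul1r.
set w := run_weight K' c' true B in h2 h3 *.
have w0 : 0 <= w by apply: run_weight_ge0.
have ccK : 0 <= c * (c * K) by rewrite mulr_ge0.
have e2 : c * rsplits K c true false B <= c * w by rewrite ler_wpM2l.
have e3 : c * rsplits K c false true B <= c * w by rewrite ler_wpM2l.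
have f2 : c * (c * K) * rsplits K c true false B <= c * (c * K) * w by rewrite ler_wpM2l.
have f3 : c * (c * K) * rsplits K c false true B <= c * (c * K) * w by rewrite ler_wpM2l.
have hw : c * (1 + c * K) * w <= c' * w by rewrite ler_wpM2r.
have hw2 : 2 * (c * (c * K)) * w <= c' * K' * w.
  rewrite ler_wpM2r // (_ : 2 * _ = c * (2 * c * K)); last by ring.
  by rewrite ler_pM // -mulrA mulr_ge0.
split; lra.
Qed.

(** The split is built from the right: a run opened in one copy is kept there as long as that copy
    is lost, which makes it right-maximal. The last two claims say that any copy lost at the first
    position can be the one used there. *)
Lemma run_event_split B u v : size u = size B -> size v = size B ->
  run_event B (andS u v) ->
  let good s := run_event s.1 u && run_event s.2 v in
  [/\ exists2 s, s \in splits B & good s,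
      head false B -> ~~ head false u ->
        exists2 s, s \in splits B & good s && head false s.1 &
      head false B -> ~~ head false v ->
        exists2 s, s \in splits B & good s && head false s.2].
Proof.
elim: B u v => [|b B IH] [|u0 u] [|v0 v] //=.
  by move=> _ _ _; split=> //; exists ([::], [::]).
move=> [su] [sv]; rewrite -/(andS u v) => /and3P[hb hs /(IH _ _ su sv)[h1 h2 h3]].
case: b hb hs => /= hb hs; last first.
  split=> //; case: h1 => s sB gs; exists (false :: s.1, false :: s.2) => //=.
  by apply/mapP; exists s.
have H1 : ~~ u0 -> exists2 s, s \in splits (true :: B) &
    run_event s.1 (u0 :: u) && run_event s.2 (v0 :: v) && head false s.1.
  move=> u0F.
  have [s sB /andP[/andP[g1 g2] g3]] : exists2 s, s \in splits B &
      run_event s.1 u && run_event s.2 v && (~~ head true s.1 ==> head false u).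
    case: B h1 h2 h3 hs su sv {IH} => [|b B] h1 h2 h3 hs su sv.
      by case: h1 => s; rewrite inE => /eqP-> g; exists ([::], [::]) => //; rewrite andbT.
    case: b su sv h1 h2 h3 hs => su sv h1 h2 h3 hs; last first.
      case: h1 => s sB g; exists s; rewrite // g /=; apply/implyP => _.
      by move: hs => /=; case: (u) (v) => [|? ?] [|? ?] //= /andP[].
    have [uT|uF] := boolP (head false u).
      by case: h1 => s sB g; exists s; rewrite // g implybT.
    have [s sB /andP[g hd]] := h2 isT uF; exists s; rewrite // g /=.
    by case: (s.1) hd => //= a l ->.
  exists (true :: s.1, false :: s.2); last by rewrite /= u0F g1 g2 g3.
  by rewrite /= mem_cat map_f.
have H2 : ~~ v0 -> exists2 s, s \in splits (true :: B) &
    run_event s.1 (u0 :: u) && run_event s.2 (v0 :: v) && head false s.2.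
  move=> v0F.
  have [s sB /andP[/andP[g1 g2] g3]] : exists2 s, s \in splits B &
      run_event s.1 u && run_event s.2 v && (~~ head true s.2 ==> head false v).
    case: B h1 h2 h3 hs su sv {IH H1} => [|b B] h1 h2 h3 hs su sv.
      by case: h1 => s; rewrite inE => /eqP-> g; exists ([::], [::]) => //; rewrite andbT.
    case: b su sv h1 h2 h3 hs => su sv h1 h2 h3 hs; last first.
      case: h1 => s sB g; exists s; rewrite // g /=; apply/implyP => _.
      by move: hs => /=; case: (u) (v) => [|? ?] [|? ?] //= /andP[].
    have [vT|vF] := boolP (head false v).
      by case: h1 => s sB g; exists s; rewrite // g implybT.
    have [s sB /andP[g hd]] := h3 isT vF; exists s; rewrite // g /=.
    by case: (s.2) hd => //= a l ->.
  exists (false :: s.1, true :: s.2); last by rewrite /= v0F g1 g2 g3.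
  by rewrite /= mem_cat orbC map_f.
split=> //; move: hb; rewrite negb_and => /orP[/H1|/H2] [s sB /andP[g _]];
  by exists s.
Qed.

Lemma size_dilate prev A : size (dilate prev A) = (size A).+1.
Proof. by elim: A prev => [|a A IH] prev //=; rewrite IH. Qed.

(** The condition on the position after a run is dropped, whence the value 1 for [K]. *)
Lemma EB_run_event {R : realType} (p : R) prev B : 0 <= p <= 1 ->
  EB p (size B) (fun x => (run_event B x)%:R) <= run_weight 1 (1 - p) prev B.
Proof.
move=> hp; elim: B prev => [|b B IH] prev //=.
have le c : EB p (size B) (fun x => (run_event (b :: B) (c :: x))%:R)
    <= (~~ (b && c))%:R * run_weight 1 (1 - p) b B.
  case: (boolP (b && c)) => [/andP[-> ->]|bc] /=.
    by rewrite EB_cst mul0r.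
  rewrite mul1r; apply: (le_trans _ (IH b)); apply: EB_le => // x _.
  by case: (run_event B x); rewrite ?andbT ?andbF // lern1 leq_b1.
have hT : p * EB p (size B) (fun x => (run_event (b :: B) (true :: x))%:R)
    <= p * ((~~ (b && true))%:R * run_weight 1 (1 - p) b B).
  by rewrite ler_wpM2l //; lra.
have hF : (1 - p) * EB p (size B) (fun x => (run_event (b :: B) (false :: x))%:R)
    <= (1 - p) * ((~~ (b && false))%:R * run_weight 1 (1 - p) b B).
  by rewrite ler_wpM2l //; lra.
apply: (le_trans (lerD hT hF)).
rewrite andbT andbF mulr1 /= if_same mul1r.
by case: b {le hT hF} => /=; lra.
Qed.

(** Union bound over [splits B], then independence of the two copies; each factor is bounded by
    dilation, or vanishes when the set is not [gap_free]. *)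
Lemma run_event_step {R : realType} (p K c : R) m j : 0 <= p <= 1 ->
  0 <= K -> 0 <= c ->
  (forall B, size B = j.+1 -> PrA p m j.+1 (run_event B) <= run_weight K c false B) ->
  forall B, size B = j -> PrA p m.+1 j (run_event B) <= rsplits K c false false B.
Proof.
move=> hp K0 c0 IH B sB.
have one A : size A = j ->
    0 <= PrA p m j.+1 (fun x => run_event A (orN x)) <= dil_weight K c false A.
  move=> sA; rewrite (andP (PrA_itv m j.+1 _ hp)).1 /=.
  have [gA|gA] := boolP (gap_free A).
    have [<- _ _] := run_weight_dilate K c gA.
    apply: (@le_trans _ _ (PrA p m j.+1 (run_event (dilate false A)))).
      apply: EX_le => // [|x sx]; first exact: shrinks_stepA.
      case: (boolP (run_event A (orN x))) => // h.
      by rewrite run_event_dilate // sx sA.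
    by apply: IH; rewrite size_dilate sA.
  rewrite /PrA (_ : EX _ _ _ _ _ = 0) ?dil_weight_ge0 //.
  rewrite -[RHS](EX_cst stepA p m j.+1); apply: EX_eq => [|x sx].
    exact: shrinks_stepA.
  case: (boolP (run_event A (orN x))) => // h; case/negP: gA.
  by apply: run_event_gap h; rewrite sx sA.
apply: (@le_trans _ _ (\sum_(s <- splits B)
   PrA p m j.+1 (fun x => run_event s.1 (orN x))
   * PrA p m j.+1 (fun x => run_event s.2 (orN x)))); last first.
  rewrite /rsplits big_seq_cond [leRHS]big_seq_cond; apply: ler_sum => s.
  rewrite andbT => /size_splits[s1 s2].
  have /andP[a0 a1] := one _ (etrans s1 sB); have /andP[b0 b1] := one _ (etrans s2 sB).
  exact: ler_pM.
rewrite /PrA /=.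
apply: (@le_trans _ _ (EX stepA p m j.+1 (fun x => EX stepA p m j.+1 (fun y =>
   \sum_(s <- splits B) (run_event s.1 (orN x))%:R * (run_event s.2 (orN y))%:R)))).
  apply: EX_le => // [|x sx]; first exact: shrinks_stepA.
  apply: EX_le => // [|y sy]; first exact: shrinks_stepA.
  case: (boolP (run_event B _)) => [h|_]; last first.
    by apply: sumr_ge0 => s _; rewrite mulr_ge0.
  have [||[s sS /andP[g1 g2]] _ _] := run_event_split _ _ h;
    rewrite ?size_orN ?sx ?sy ?sB //.
  rewrite (perm_big _ (perm_to_rem sS)) big_cons g1 g2 mulr1 lerDl.
  by apply: sumr_ge0 => s' _; rewrite mulr_ge0.
rewrite (_ : (fun x => EX _ _ _ _ _) = (fun x => \sum_(s <- splits B)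
    EX stepA p m j.+1 (fun y => (run_event s.2 (orN y))%:R)
     * (run_event s.1 (orN x))%:R)); last first.
  apply/funext => x; rewrite linearF_sum; last exact: linearF_EX.
  by apply: eq_bigr => s _; rewrite linearFZ 1?mulrC //; exact: linearF_EX.
rewrite linearF_sum; last exact: linearF_EX.
rewrite le_eqVlt; apply/orP; left; apply/eqP; apply: eq_bigr => s _.
by rewrite linearFZ 1?mulrC //; exact: linearF_EX.
Qed.

(** At m = 0 the constants are 1 and 1/8 = 1 - 7/8. As c stays below 1/4, 2cK <= K/2 and c^2 K <=
    K/16, which is the increment of c. *)
Lemma run_event_le {R : realType} m B :
  PrA (7 / 8 : R) m (size B) (run_event B)
  <= run_weight (2 ^- m) (1 / 4 - 2 ^- m / 8) false B.
Proof.
have hp : 0 <= (7 / 8 : R) <= 1 by lra.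
elim: m B => [|m IH] B.
  rewrite expr0 invr1 (_ : 1 / 4 - 1 / 8 = 1 - 7 / 8); last by field.
  exact: EB_run_event.
have i0 : 0 < 2 ^- m :> R by rewrite invr_gt0 exprn_gt0.
have i1 : 2 ^- m <= 1 :> R by rewrite invf_le1 ?exprn_ege1 ?exprn_gt0 //; lra.
have iS : 2 ^- m.+1 = 2 ^- m / 2 :> R.
  by rewrite exprS invfM mulrC.
rewrite iS; set K := 2 ^- m in i0 i1 IH *.
pose c : R := 1 / 4 - K / 8.
have c0 : 0 <= c by rewrite /c; lra.
apply: (@le_trans _ _ (rsplits K c false false B)).
  apply: run_event_step => //; first exact: ltW.
  by move=> B' <-; apply: IH.
have [] // := @rsplits_le R K c (K / 2) (1 / 4 - K / 2 / 8) B (ltW i0) c0.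
- have : c * K <= 1 / 4 * K by rewrite ler_pM2r // /c; lra.
  by lra.
- have : c * (c * K) <= 1 / 4 * (1 / 4 * K).
    rewrite ler_pM ?mulr_ge0 ?ler_pM2r //; rewrite /c; lra.
  by rewrite /c; lra.
Qed.

Lemma PrA_supercritical {R : realType} m :
  3 / 4 <= PrA (7 / 8 : R) m 1 (head false).
Proof.
have hp : 0 <= (7 / 8 : R) <= 1 by lra.
have e : PrA (7 / 8 : R) m 1 (head false) = 1 - PrA (7 / 8) m 1 (run_event [:: true]).
  rewrite /PrA -[X in X - _](EX_cst stepA (7 / 8) m 1) -linearFB; last exact: linearF_EX.
  apply: EX_eq => [|[|a []] // _]; first exact: shrinks_stepA.
  by case: a; rewrite /= ?subr0 ?subrr.
have := @run_event_le R m [:: true]; rewrite e /= mulr1.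
have i0 : 0 < 2 ^- m :> R by rewrite invr_gt0 exprn_gt0.
have i1 : 2 ^- m <= 1 :> R by rewrite invf_le1 ?exprn_ege1 ?exprn_gt0 //; lra.
set K := 2 ^- m in i0 i1 *.
have : (1 / 4 - K / 8) * K <= 1 / 4 * 1 by rewrite ler_pM //; lra.
by lra.
Qed.

(** * Marginals and the recursion for [rho] *)

Lemma EBS {R : realType} (p : R) j f :
  EB p j.+1 f = p * EB p j (fun x => f (true :: x))
                + (1 - p) * EB p j (fun x => f (false :: x)).
Proof. by []. Qed.

Lemma EB_behead {R : realType} (p : R) j f :
  EB p j.+1 (fun x => f (behead x)) = EB p j f.
Proof. by rewrite /=; ring. Qed.

Lemma EB_take {R : realType} (p : R) j f :
  EB p j.+1 (fun x => f (take j x)) = EB p j f.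
Proof.
elim: j f => [|j IH] f; first by rewrite /=; ring.
by rewrite EBS [RHS]EBS -!IH.
Qed.

Lemma behead_orN x : behead (orN x) = orN (behead x).
Proof. by case: x => [|a [|b x]]. Qed.

Lemma behead_andS x y : behead (andS x y) = andS (behead x) (behead y).
Proof. by case: x y => [|a [|a' x]] [|b [|b' y]]. Qed.

Lemma take_orN j x : take j (orN x) = orN (take j.+1 x).
Proof.
elim: j x => [|j IH] [|a [|b x]] //.
by congr cons; exact: (IH (b :: x)).
Qed.

Lemma take_andS j x y : take j (andS x y) = andS (take j x) (take j y).
Proof. by elim: j x y => [|j IH] [|a x] [|b y] //; congr cons; exact: IH. Qed.

(** With [EX_take], stationarity: the step commutes with dropping a bit at either end. *)
Lemma EX_behead {R : realType} (p : R) m j f :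
  EX stepA p m j.+1 (fun x => f (behead x)) = EX stepA p m j f.
Proof.
elim: m j f => [|m IH] j f; first exact: EB_behead.
rewrite /= -[RHS]IH; congr EX; apply/funext => x; rewrite -[RHS]IH; congr EX.
by apply/funext => y; rewrite /stepA behead_andS !behead_orN.
Qed.

Lemma EX_take {R : realType} (p : R) m j f :
  EX stepA p m j.+1 (fun x => f (take j x)) = EX stepA p m j f.
Proof.
elim: m j f => [|m IH] j f; first exact: EB_take.
rewrite /= -[RHS]IH; congr EX; apply/funext => x; rewrite -[RHS]IH; congr EX.
by apply/funext => y; rewrite /stepA take_andS !take_orN.
Qed.

Definition rho {R : realType} (p : R) (m : nat) : R := PrA p m 1 (head false).

Lemma rho_itv {R : realType} (p : R) m : 0 <= p <= 1 -> 0 <= rho p m <= 1.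
Proof. exact: PrA_itv. Qed.

Lemma PrA_or2 {R : realType} (p : R) m : 0 <= p <= 1 ->
  rho p m <= PrA p m 2 (fun x => nth false x 0 || nth false x 1) <= 2 * rho p m.
Proof.
move=> hp.
have e0 : rho p m = PrA p m 2 (fun x => nth false x 0).
  rewrite /rho /PrA -(EX_take p m 1 (fun x => (head false x)%:R)).
  by congr EX; apply/funext => -[|a x].
have e1 : rho p m = PrA p m 2 (fun x => nth false x 1).
  rewrite /rho /PrA -(EX_behead p m 1 (fun x => (head false x)%:R)).
  by congr EX; apply/funext => -[|a [|b x]].
apply/andP; split.
  rewrite e0; apply: EX_le => // [|x _]; first exact: shrinks_stepA.
  by case: (nth _ _ _) => //=; rewrite ler01.
rewrite mulr_natl mulr2n {1}e0 e1 /PrA -linearFD; last exact: linearF_EX.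
apply: EX_le => // [|x _]; first exact: shrinks_stepA.
by case: (nth _ _ _); case: (nth _ _ _); rewrite /= ?addr0 ?add0r ?lerDl ?ler01.
Qed.

Lemma rhoS {R : realType} (p : R) m :
  rho p m.+1 = PrA p m 2 (fun x => nth false x 0 || nth false x 1) ^+ 2.
Proof.
rewrite /rho /PrA /= expr2 -linearFZ; last exact: linearF_EX.
apply: EX_eq => [|[|a [|b []]] // _]; first exact: shrinks_stepA.
rewrite mulrC -linearFZ; last exact: linearF_EX.
apply: EX_eq => [|[|c [|d []]] // _]; first exact: shrinks_stepA.
by rewrite /= -natrM mulnb.
Qed.

Lemma rhoS_le {R : realType} (p : R) m : 0 <= p <= 1 ->
  rho p m.+1 <= 4 * rho p m ^+ 2.
Proof.
move=> hp; have /andP[h1 h2] := PrA_or2 m hp; have /andP[r0 _] := rho_itv m hp.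
have := ler_pM (le_trans r0 h1) (le_trans r0 h1) h2 h2.
by rewrite rhoS !expr2; lra.
Qed.

(** By [rhoS_le], [4 * rho] is at most squared at each step; only geometric decay is kept of
    this. *)
Lemma rho_cvg0 {R : realType} (p : R) m : 0 <= p <= 1 -> rho p m < 1 / 4 ->
  rho p n @[n --> \oo] --> (0 : R).
Proof.
move=> hp h; pose r := 4 * rho p m.
have /andP[r0 _] := rho_itv m hp.
have r00 : 0 <= r by rewrite mulr_ge0.
have r1 : r < 1 by rewrite /r; lra.
have hk k : 4 * rho p (k + m)%N <= r ^+ k.+1.
  elim: k => [|k IH]; first by rewrite expr1.
  have s0 : 0 <= 4 * rho p (k + m)%N by have /andP[] := rho_itv (k + m) hp; lra.
  rewrite addSn; apply: (@le_trans _ _ ((4 * rho p (k + m)%N) ^+ 2)).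
    by have := rhoS_le (k + m) hp; rewrite !expr2; lra.
  apply: (@le_trans _ _ (r ^+ k.+1 * r ^+ k.+1)); first by rewrite expr2 ler_pM.
  rewrite -exprD; apply: ler_wiXn2l => //; [exact: ltW|lia].
have z1 : `|r| < 1 by rewrite ger0_norm.
have cv : (fun n => r ^+ n) @ \oo --> (0 : R) by exact: (@cvg_expr R r z1).
move/cvgrPdist_lt: cv => cv; apply/cvgrPdist_lt => e e0.
have [n0 _ hn0] := cv _ e0.
exists (n0 + m)%N => // n /= hn.
have -> : n = (n - m + m)%N by lia.
have /andP[a0 _] := rho_itv (n - m + m) hp.
rewrite sub0r normrN ger0_norm //.
have := hn0 (n - m).+1; rewrite /= sub0r normrN ger0_norm ?exprn_ge0 // => hh.
have /hh h2 : (n0 <= (n - m).+1)%N by lia.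
by have := hk (n - m)%N; lra.
Qed.

(** * Dependence of [rho] on the parameter *)

Lemma increasing_head j : increasing j (head false).
Proof. by move=> [|a x] [|b y] //= _ _ h; [have := h 0%N|have := h 0%N]. Qed.

Lemma is_derive_rho {R : realType} (p : R) m :
  is_derive p 1 (fun q => rho q m) (DX p m 1 (fun x => (head false x)%:R)).
Proof.
apply: is_derive_eq (is_derive_EX m 1 (f := fun _ x => (head false x)%:R)
  (df := fun=> 0) _) _ => [x|]; first exact: is_derive_cst.
by rewrite EX_cst addr0.
Qed.

Lemma rho_MVT {R : realType} (p q : R) m : p < q ->
  exists2 c, p < c < q &
    rho q m - rho p m = DX c m 1 (fun x => (head false x)%:R) * (q - p).
Proof.
move=> pq; have [|c] := @MVT R (fun q => rho q m)
  (fun c => DX c m 1 (fun x => (head false x)%:R)) _ _ pq (fun x _ => is_derive_rho x m).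
  by apply: derivable_within_continuous => x _; apply: ex_derive; exact: is_derive_rho.
by rewrite in_itv /= => hc e; exists c.
Qed.

Lemma rho_le {R : realType} (p q : R) m : 0 <= p -> p <= q -> q <= 1 ->
  rho p m <= rho q m.
Proof.
move=> p0; rewrite le_eqVlt => /orP[/eqP->//|pq] q1.
have [c hc] := rho_MVT m pq; rewrite -subr_ge0 => ->.
have hc1 : 0 <= c <= 1 by lra.
have [h _] := DX_entropy m hc1 (@increasing_head 1).
by rewrite mulr_ge0 ?subr_ge0 ?(ltW pq) // (le_trans _ h) // entropy_ge0 // PrA_itv.
Qed.

(** Opens the subcritical set to the right, so that a limit 0 places [p] strictly below the
    threshold. *)
Lemma rho_right_cont {R : realType} (p a : R) m : rho p m < a -> p < 1 ->
  exists2 q, p < q <= 1 & rho q m < a.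
Proof.
move=> h p1.
have /cvgrPdist_lt cv : {for p, continuous (fun q : R => rho q m)}.
  apply/differentiable_continuous/derivable1_diffP/ex_derive.
  exact: is_derive_rho.
have d0 : 0 < a - rho p m by lra.
have [d /= dpos hd] := cv _ d0.
pose q := Num.min 1 (p + d / 2).
have pq : p < q by rewrite /q lt_min p1 ltrDl; lra.
have qd : q <= p + d / 2 by rewrite /q ge_min lexx orbT.
exists q; first by rewrite pq /q ge_min lexx.
have := hd q; rewrite /ball_ /= ltr0_norm ?subr_lt0 // => /(_ _).
have hq : - (p - q) < d by lra.
move=> /(_ hq); rewrite ltr_norml => /andP[]; lra.
Qed.

Lemma rho_cvg1 {R : realType} (p q : R) : 0 <= p -> p < q -> q <= 1 ->
  (forall m, 1 / 4 <= rho p m) -> rho q n @[n --> \oo] --> (1 : R).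
Proof.
move=> p0 pq q1 hp; apply/cvgrPdist_lt => e e0.
have eqp : 0 < e * (q - p) by rewrite mulr_gt0 ?subr_gt0.
(* If [rho q n <= 1 - e], the variance on the whole interval is at least e/4, so [rho] would grow by
   at least t e (q - p)/8 > 1. *)
pose t := 8 / (e * (q - p)) + 1.
have i0 : 0 < 8 / (e * (q - p)) by rewrite divr_gt0.
have t1 : 1 <= t by rewrite /t; lra.
have [m0 hm0] := DX_variance t1.
exists m0 => // n /= hn.
have hq : 0 <= q <= 1 by lra.
have /andP[a0 a1] := rho_itv n hq.
rewrite ger0_norm ?subr_ge0 // ltNge; apply/negP => hle.
have [c hc] := rho_MVT n pq.
have hc1 : 0 <= c <= 1 by lra.
have lo := hp n; have /andP[_ b1] := rho_itv n hc1.
have c1 : rho p n <= rho c n by apply: rho_le; lra.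
have c2 : rho c n <= rho q n by apply: rho_le; lra.
have := hm0 n hn c 1%N (head false) hc1 (@increasing_head 1).
rewrite -/(rho c n); set D := DX _ _ _ _ => hD eD.
have v : 1 / 4 * e <= rho c n * (1 - rho c n) by rewrite ler_pM //; lra.
have : t / 2 * (1 / 4 * e) <= D by apply: le_trans hD; rewrite ler_wpM2l //; lra.
move=> /(ler_wpM2r (_ : 0 <= q - p)); rewrite subr_ge0 => /(_ (ltW pq)).
rewrite -eD.
have -> : t / 2 * (1 / 4 * e) * (q - p) = 1 + e * (q - p) / 8.
  by rewrite /t; field; rewrite !gt_eqF // subr_gt0.
by lra.
Qed.

(** * Strategies and backward induction *)

Fixpoint wins (n : nat) (G : seq bool -> seq bool -> bool) : bool :=
  if n is n'.+1
  then (wins n' (fun a b => G (true :: a) (true :: b))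
        || wins n' (fun a b => G (true :: a) (false :: b)))
       && (wins n' (fun a b => G (false :: a) (true :: b))
           || wins n' (fun a b => G (false :: a) (false :: b)))
  else G [::] [::].

Lemma eq_wins n G G' : (forall a b, G a b = G' a b) -> wins n G = wins n G'.
Proof.
by move=> h; congr wins; apply/funext => a; apply/funext => b.
Qed.

Lemma winsS n G : wins n.+1 G <->
  forall x, exists y, wins n (fun a b => G (x :: a) (y :: b)).
Proof.
split=> [/andP[/orP ht /orP hf] [] | h].
- by case: ht => h; [exists true|exists false].
- by case: hf => h; [exists true|exists false].
- by apply/andP; split; apply/orP;
  [have [[] hy] := h true|have [[] hy] := h false]; by [left|right].
Qed.

Lemma play_aux_ext s s' a pa pb :
  (forall u v, s (pa ++ u) (pb ++ v) = s' (pa ++ u) (pb ++ v)) ->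
  play_aux s a pa pb = play_aux s' a pa pb.
Proof.
elim: a pa pb => [//|x a IH] pa pb h /=.
have e : s (rcons pa x) pb = s' (rcons pa x) pb.
  by have := h [:: x] [::]; rewrite cats0 cats1.
by rewrite e; congr cons; apply: IH => u v; rewrite !cat_rcons.
Qed.

Lemma size_play_aux s a pa pb : size (play_aux s a pa pb) = size a.
Proof. by elim: a pa pb => [//|x a IH] pa pb /=; rewrite IH. Qed.

(** The histories [pa] and [pb] are arbitrary so that the induction can move past the first
    round. *)
Lemma wins_strategy n G pa pb : wins n G <->
  exists s : strategy, forall a, size a = n -> G a (play_aux s a pa pb).
Proof.
elim: n G pa pb => [|n IH] G pa pb.
  split=> [h|[s h]]; last exact: (h [::]).
  by exists (fun _ _ => true) => -[].
rewrite winsS; split=> [h|[s h] x]; last first.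
  exists (s (rcons pa x) pb); apply/(IH _ (rcons pa x) (rcons pb (s (rcons pa x) pb))).
  by exists s => a sa; apply: (h (x :: a)); rewrite /= sa.
have [y hy] := choice h.
have /choice [S hS] : forall x, exists s : strategy, forall a, size a = n ->
    G (x :: a) (y x :: play_aux s a (rcons pa x) (rcons pb (y x))).
  by move=> x; have /(IH _ (rcons pa x) (rcons pb (y x))) := hy x.
(* The glued strategy reads Alice's first move at index [size pa]; Bob is at his first answer
   exactly when his history still has length [size pb]. *)
exists (fun qa qb => let x := nth false qa (size pa) in
          if size qb == size pb then y x else S x qa qb) => -[//|x a] [sa] /=.
have nx u : nth false (rcons pa x ++ u) (size pa) = x.
  by rewrite cat_rcons nth_cat ltnn subnn.
have := nx [::]; rewrite cats0 => ->; rewrite eqxx.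
rewrite (_ : play_aux _ _ _ _ = play_aux (S x) a (rcons pa x) (rcons pb (y x))).
  exact: hS.
apply: play_aux_ext => u v; rewrite nx size_cat size_rcons.
by rewrite (_ : ((size pb).+1 + size v == size pb)%N = false) //; lia.
Qed.

(** * The two games as automata *)

(* The vector of winners over the [N - m] values of the counter with which the
   last [m] rounds may start. *)
Fixpoint values (st : seq bool -> seq bool -> seq bool) (m N : nat)
    (H : seq bool -> nat -> bool) : seq bool :=
  if m is m'.+1
  then st (values st m' N (fun a => H (true :: a)))
          (values st m' N (fun a => H (false :: a)))
  else [seq H [::] k | k <- iota 0 N].

Lemma size_values st m j H : shrinks st -> size (values st m (m + j) H) = j.
Proof.
move=> hst; elim: m j H => [|m IH] j H /=; first by rewrite size_map size_iota.
by apply: hst; rewrite addSnnS.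
Qed.

Lemma nth_values_stepA m j H k : (k < j)%N ->
  nth false (values stepA m (m + j) H) k
  = wins m (fun a b => H a (k + count id b)%N).
Proof.
elim: m j H k => [|m IH] j H k kj.
  by rewrite /= (nth_map 0%N) ?size_iota // nth_iota // addn0.
rewrite [LHS]/= /stepA nth_andS !nth_orN addSnnS !size_values; try exact: shrinks_stepA.
rewrite !ltnS kj /= !IH ?ltnS // 1?ltnW //.
rewrite [X in _ = X && _]orbC [X in _ = _ && X]orbC.
by congr ((_ || _) && (_ || _)); apply: eq_wins => a b /=; congr H; lia.
Qed.

Definition orS (x y : seq bool) : seq bool := [seq u.1 || u.2 | u <- zip x y].
Definition negS (x : seq bool) : seq bool := map negb x.
(** One round of aB: Alice's move acts on the counter, hence the AND of neighbours; Bob's answer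
    selects the copy, hence the OR of copies. *)
Definition stepB (x y : seq bool) : seq bool :=
  [seq u.1 && u.2 | u <- zip (orS x y) (behead (orS x y))].

Lemma size_orS x y : size x = size y -> size (orS x y) = size x.
Proof. by move=> e; rewrite size_map size_zip e minnn. Qed.

Lemma shrinks_stepB : shrinks stepB.
Proof.
move=> j x y hx hy; rewrite size_map size_zip size_behead size_orS hx ?hy //; lia.
Qed.

(** De Morgan: for Alice's wins, a round of aB performs the operations of [stepA] in the opposite
    order. *)
Lemma stepB_negS x y :
  stepB (negS x) (negS y) = negS (orN (andS x y)).
Proof.
have e : orS (negS x) (negS y) = negS (andS x y).
  elim: x y => [|a x IH] [|b y] //; have := IH y; rewrite /orS /andS /negS /= => ->.
  by rewrite negb_and.
rewrite /stepB e; elim: (andS x y) => [//|a [//|b z] IH].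
by move: IH; rewrite orN_cons /= => ->; rewrite negb_or.
Qed.

Lemma negSK x : negS (negS x) = x.
Proof. by rewrite /negS -map_comp map_id_in // => b _ /=; rewrite negbK. Qed.

Lemma nth_stepB j x y k : size x = j.+1 -> size y = j.+1 -> (k < j)%N ->
  nth false (stepB x y) k = (nth false x k || nth false y k)
                            && (nth false x k.+1 || nth false y k.+1).
Proof.
move=> sx sy kj.
have so : size (orS x y) = j.+1 by rewrite size_orS sx ?sy.
have no i : (i < j.+1)%N -> nth false (orS x y) i = nth false x i || nth false y i.
  move=> ij; rewrite (nth_map (false, false)) ?size_zip ?sx ?sy ?minnn //.
  by rewrite nth_zip ?sx ?sy.
rewrite (nth_map (false, false)); last by rewrite size_zip size_behead so; lia.
rewrite nth_zip_cond size_zip size_behead so /=.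
rewrite (_ : (k < _)%N) /=; last by lia.
by rewrite nth_behead !no //; lia.
Qed.

Lemma nth_values_stepB m j H k : (k < j)%N ->
  nth false (values stepB m (m + j) H) k
  = wins m (fun a b => H b (k + count id a)%N).
Proof.
elim: m j H k => [|m IH] j H k kj.
  by rewrite /= (nth_map 0%N) ?size_iota // nth_iota // addn0.
rewrite [LHS]/= (@nth_stepB j) ?addSnnS ?size_values //; try exact: shrinks_stepB.
rewrite !IH ?ltnS // 1?ltnW // andbC.
by congr ((_ || _) && (_ || _)); apply: eq_wins => a b /=; congr H; lia.
Qed.

(** * Random assignments as independent bits *)

Fixpoint points (m N : nat) : seq (seq bool * nat) :=
  if m is m'.+1
  then [seq (true :: u.1, u.2) | u <- points m' N]
       ++ [seq (false :: u.1, u.2) | u <- points m' N]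
  else [seq ([::], k) | k <- iota 0 N].

Lemma size_points m N : size (points m N) = (2 ^ m * N)%N.
Proof.
elim: m => [|m IH] /=; first by rewrite size_map size_iota mul1n.
by rewrite size_cat !size_map IH expnS; lia.
Qed.

Lemma mem_points m N u : u \in points m N -> size u.1 = m /\ (u.2 < N)%N.
Proof.
elim: m u => [|m IH] u /=; first by move=> /mapP[k]; rewrite mem_iota => h ->.
by rewrite mem_cat => /orP[] /mapP[w /IH[h1 h2] ->]; rewrite /= h1.
Qed.

Lemma uniq_points m N : uniq (points m N).
Proof.
elim: m => [|m IH] /=; first by rewrite map_inj_uniq ?iota_uniq // => k l [].
rewrite cat_uniq !map_inj_uniq ?IH //=; try by move=> [? ?] [? ?] [-> ->].
rewrite andbT; apply/hasPn => _ /mapP[w _ ->]; apply/negP => /mapP[w' _]; discriminate.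
Qed.

(** The recursion of [values], run on the flat list of winners in the order of [points]. *)
Fixpoint lvalues (st : seq bool -> seq bool -> seq bool) (m N : nat)
    (x : seq bool) : seq bool :=
  if m is m'.+1
  then st (lvalues st m' N (take (2 ^ m' * N) x)) (lvalues st m' N (drop (2 ^ m' * N) x))
  else x.

Lemma lvalues_points st m N H :
  lvalues st m N [seq H u.1 u.2 | u <- points m N] = values st m N H.
Proof.
elim: m H => [|m IH] H /=; first by rewrite -map_comp.
have s : size [seq H u.1 u.2 | u <- [seq (true :: u.1, u.2) | u <- points m N]]
    = (2 ^ m * N)%N by rewrite !size_map size_points.
rewrite map_cat take_size_cat // drop_size_cat // -!map_comp.
by rewrite -!IH.
Qed.

Lemma EB_cat {R : realType} (p : R) i j f :
  EB p (i + j) f = EB p i (fun x => EB p j (fun y => f (x ++ y))).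
Proof. by elim: i f => [//|i IH] f; rewrite addSn EBS [RHS]EBS !IH. Qed.

Lemma EB_eq {R : realType} (p : R) j f g :
  (forall x, size x = j -> f x = g x) -> EB p j f = EB p j g.
Proof. exact: (EX_eq p 0 shrinks_stepA). Qed.

Lemma EX_lvalues {R : realType} st (p : R) m j f :
  EX st p m j f = EB p (2 ^ m * (m + j)) (fun x => f (lvalues st m (m + j) x)).
Proof.
elim: m j f => [|m IH] j f; first by rewrite mul1n add0n.
rewrite [LHS]/= IH expnS mulSn mul1n mulnDl EB_cat addSnnS.
apply: EB_eq => x sx; rewrite IH; apply: EB_eq => y sy.
by rewrite [lvalues st m.+1 _ _]/= take_size_cat // drop_size_cat.
Qed.

Lemma sum_weight {R : realType} (T : finType) (p : R) (s : seq T) f : uniq s ->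
  \sum_(W : {ffun T -> bool}) weight p W * f [seq W o | o <- s] = EB p (size s) f.
Proof.
elim: s f => [|o s IH] f.
  move=> _; rewrite /= -big_distrl /= (_ : \sum_W _ = 1) ?mul1r //.
  rewrite /weight -(bigA_distr_bigA (fun _ (b : bool) => if b then p else 1 - p)) /=.
  by rewrite big1 // => i _; rewrite big_bool /= addrC subrK.
move=> /= /andP[os us].
pose w (b : bool) : R := if b then p else 1 - p.
(* Changing the winner of [o] exchanges the two halves of the sum and changes only one factor of the
   weight. *)
pose flip (W : {ffun T -> bool}) : {ffun T -> bool} := [ffun x => if x == o then ~~ W x else W x].
have flipK : involutive flip.
  by move=> W; apply/ffunP => x; rewrite !ffunE; case: eqP; rewrite ?negbK.
have flips W : [seq flip W x | x <- s] = [seq W x | x <- s].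
  apply/eq_in_map => x xs; rewrite ffunE; case: eqP => // e.
  by move: os; rewrite -e xs.
have flipo W : flip W o = ~~ W o by rewrite ffunE eqxx.
have flipw (W : {ffun T -> bool}) : w (W o) * weight p (flip W) = w (~~ W o) * weight p W.
  rewrite /weight (bigD1 o) //= [in RHS](bigD1 o) //= -/(w _) -/(w _) flipo.
  rewrite mulrCA; congr (_ * (_ * _)); apply: eq_bigr => x /negbTE xo.
  by rewrite ffunE xo.
pose A b g := \sum_(W : {ffun T -> bool} | W o == b) weight p W * g [seq W x | x <- s].
have split F : \sum_(W : {ffun T -> bool}) F W
   = \sum_(W : {ffun T -> bool} | W o == true) F W
     + \sum_(W : {ffun T -> bool} | W o == false) F W :> R.
  rewrite (bigID (fun W : {ffun T -> bool} => W o)) /=; congr (_ + _);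
  by apply: eq_bigl => W; case: (W o).
have Aflip b g : w (~~ b) * A b g = w b * A (~~ b) g.
  rewrite /A (reindex_inj (inv_inj flipK)) /= !big_distrr /=.
  apply: eq_big => [W|W /eqP h]; first by rewrite flipo; case: (W o); case: b.
  have e : W o = ~~ b by rewrite -h flipo negbK.
  by rewrite flips !mulrA -e flipw e negbK.
have w1 b : w b + w (~~ b) = 1 by rewrite /w; case: b; rewrite /= ?subrK // addrC subrK.
(* Multiply by [w b + w (~~ b) = 1] and exchange the halves in the second term: [w b] factors out of
   the whole sum. *)
have AE b g : A b g = w b * EB p (size s) g.
  rewrite -IH // split -/(A true g) -/(A false g).
  rewrite -[LHS]mul1r -(w1 b) mulrDl Aflip -mulrDr.
  by case: b => //; congr (_ * _); exact: addrC.
rewrite split -(AE true (fun x => f (true :: x))) -(AE false (fun x => f (false :: x))).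
by congr (_ + _); apply: eq_bigr => W /eqP ->.
Qed.

Definition tup (n : nat) (a : seq bool) : n.-tuple bool := [tuple nth false a i | i < n].

Lemma tupE n a : size a = n -> tup n a = a :> seq bool.
Proof.
move=> sa; apply: (@eq_from_nth _ false); rewrite size_tuple // => i hi.
by rewrite -[i]/(val (Ordinal hi)) -tnth_nth tnth_mktuple.
Qed.

Lemma tupK n (a : n.-tuple bool) : tup n a = a.
Proof. by apply: val_inj; rewrite /= tupE // size_tuple. Qed.

Lemma sum_weight_values {R : realType} (T : finType) (p : R) st n
    (o : seq bool -> nat -> T) (g : seq bool -> R) :
  {in points n n.+1 &, injective (fun u => o u.1 u.2)} ->
  \sum_(W : {ffun T -> bool}) weight p W * g (values st n n.+1 (fun a k => W (o a k)))
  = EX st p n 1 g.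
Proof.
move=> oinj; rewrite EX_lvalues addn1 -size_points.
rewrite -(size_map (fun u => o u.1 u.2)) -sum_weight; last first.
  by rewrite map_inj_in_uniq ?uniq_points.
by apply: eq_bigr => W _; rewrite -lvalues_points -map_comp.
Qed.

Lemma tup_inord_inj n : {in points n n.+1 &,
  injective (fun u => (tup n u.1, inord u.2 : 'I_n.+1))}.
Proof.
move=> [a k] [b l] /mem_points[/= sa kn] /mem_points[/= sb ln] e.
have := congr1 (fun u => tval u.1) e; have := congr1 (fun u => val u.2) e.
by rewrite /= !inordK // => -> ab; rewrite -(tupE sa) -(tupE sb) /= ab.
Qed.

Lemma bob_moves_play n s (a : n.-tuple bool) : bob_moves s a = tup n (play_aux s a [::] [::]).
Proof. by []. Qed.

Lemma P_Ab_rho {R : realType} n (p : R) : P_Ab n p = rho p n.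
Proof.
rewrite /P_Ab /rho /PrA.
rewrite -(@sum_weight_values _ (outAb n) p _ n (fun a k => (tup n a, inord k))
  (fun x => (head false x)%:R)); last exact: tup_inord_inj.
apply: eq_bigr => W _; congr (_ * _%:R); congr nat_of_bool.
have := @nth_values_stepA n 1 (fun a k => W (tup n a, inord k)) 0 isT.
rewrite nth0 addn1 => ->; apply/asboolP/idP.
  case=> s hs; apply/(wins_strategy _ _ [::] [::]); exists s => a sa.
  have := hs (tup n a); rewrite bob_moves_play /ones !tupE ?add0n //.
  by rewrite size_play_aux.
move/(wins_strategy _ _ [::] [::]) => [s hs]; exists s => a.
have := hs a (size_tuple a); rewrite tupK add0n /ones bob_moves_play tupE //.
by rewrite size_play_aux size_tuple.
Qed.

Lemma P_aB_stepB {R : realType} n (p : R) :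
  P_aB n p = EX stepB p n 1 (fun x => (head false x)%:R).
Proof.
rewrite /P_aB.
rewrite -(@sum_weight_values _ (outaB n) p _ n (fun a k => (inord k, tup n a))); last first.
  move=> u v hu hv e; apply: (tup_inord_inj hu hv).
  exact: (congr2 pair (congr1 snd e) (congr1 fst e)).
apply: eq_bigr => W _; congr (_ * _%:R); congr nat_of_bool.
have := @nth_values_stepB n 1 (fun a k => W (inord k, tup n a)) 0 isT.
rewrite nth0 addn1 => ->; apply/asboolP/idP.
  case=> s hs; apply/(wins_strategy _ _ [::] [::]); exists s => a sa.
  by have := hs (tup n a); rewrite bob_moves_play /ones !tupE ?add0n.
move/(wins_strategy _ _ [::] [::]) => [s hs]; exists s => a.
by have := hs a (size_tuple a); rewrite add0n /ones bob_moves_play.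
Qed.

(** * Reduction of aB to Ab *)

Lemma EB_and_neg {R : realType} (p : R) j h :
  EB p j (fun x => EB p j (fun y => h (andS (negS x) (negS y))))
  = EB ((1 - p) ^+ 2) j h.
Proof.
elim: j h => [//|j IH] h.
have d (k l : seq bool -> seq bool -> R) :
    EB p j (fun x => p * EB p j (k x) + (1 - p) * EB p j (l x))
    = p * EB p j (fun x => EB p j (k x)) + (1 - p) * EB p j (fun x => EB p j (l x)).
  by rewrite linearFD ?linearFZ //; apply: linearF_EB.
rewrite EBS /= !d.
rewrite -(IH (fun x => h (true :: x))) -(IH (fun x => h (false :: x))).
rewrite /andS /=; ring.
Qed.

(* The first AND acts on independent bits, so it only squares their parameter. *)
Lemma EX_stepB {R : realType} (p : R) m j f :
  EX stepB p m.+1 j f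
  = EX stepA ((1 - p) ^+ 2) m j.+1 (fun x => f (negS (orN x))).
Proof.
elim: m j f => [|m IH] j f.
  rewrite -[RHS]/(EB ((1 - p) ^+ 2) j.+1 (fun x => f (negS (orN x)))) -EB_and_neg.
  rewrite -[LHS]/(EB p j.+1 (fun x => EB p j.+1 (fun y => f (stepB x y)))).
  congr EB; apply/funext => x.
  by congr EB; apply/funext => y; rewrite -stepB_negS !negSK.
rewrite -[LHS]/(EX stepB p m.+1 j.+1 (fun x => EX stepB p m.+1 j.+1
  (fun y => f (stepB x y)))) IH [RHS]/=.
congr EX; apply/funext => x; rewrite IH.
by congr EX; apply/funext => y; rewrite stepB_negS.
Qed.

Lemma P_aB_PrA {R : realType} n (p : R) :
  P_aB n.+1 p
  = 1 - PrA ((1 - p) ^+ 2) n 2 (fun x => nth false x 0 || nth false x 1).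
Proof.
rewrite P_aB_stepB EX_stepB /PrA; set q := _ ^+ 2.
rewrite -[X in X - _](EX_cst stepA q n 2).
rewrite -linearFB; last exact: linearF_EX.
apply: EX_eq => [|[|a [|b []]] // _]; first exact: shrinks_stepA.
by case: a; case: b; rewrite /= ?subrr ?subr0.
Qed.

(** * The thresholds *)

Lemma rho_threshold (R : realType) :
  exists2 pc : R, 0 < pc < 1 &
    forall p : R, 0 <= p <= 1 ->
      (rho p n @[n --> \oo] --> (0 : R) <-> p < pc)
      /\ (pc < p -> rho p n @[n --> \oo] --> (1 : R)).
Proof.
(* One value below 1/4 already forces the limit 0. [E] contains 1/8 because [rho p 0] is [p], and
   survival bounds it by 7/8. *)
pose E : set R := [set p | 0 <= p <= 1 /\ exists m, rho p m < 1 / 4].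
have E8 : E (1 / 8).
  by split; [lra|exists 0%N; rewrite /rho /PrA /=; lra].
have ubE p : E p -> p <= 7 / 8.
  move=> [hp [m hm]]; rewrite leNgt; apply/negP => h.
  have : rho (7 / 8) m <= rho p m by apply: rho_le; lra.
  by have := @PrA_supercritical R m; rewrite -/(rho _ _); lra.
have hub : has_ubound E by exists (7 / 8) => p /ubE.
have leE p : E p -> p <= sup E by move=> h; exact: ub_le_sup.
have pc78 : sup E <= 7 / 8 by apply: ge_sup => //; exists (1 / 8).
have pc18 := leE _ E8.
exists (sup E); first lra.
move=> p hp; split; last first.
  (* The midpoint is above [sup E], so [rho] never drops below 1/4 there, which leaves an interval
     up to [p] for the mean value argument. *)
  move=> ltp; apply: (@rho_cvg1 _ ((sup E + p) / 2)); try lra.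
  move=> m; rewrite leNgt; apply/negP => h.
  have : E ((sup E + p) / 2) by split; [lra|exists m].
  by move/leE; lra.
split.
  move=> /cvgrPdist_lt cv.
  have h14 : 0 < 1 / 4 :> R by lra.
  have [m _ hm] := cv _ h14.
  have /andP[r0 _] := rho_itv m hp.
  have := hm m (leqnn m); rewrite /= sub0r normrN ger0_norm // => hr.
  have p1 : p < 1 by have := ubE p (conj hp (ex_intro _ m hr)); lra.
  have [q /andP[pq q1] hq] := rho_right_cont hr p1.
  have : E q by split; [lra|exists m].
  by move/leE; lra.
move=> ltp; have [q [hq [m hm]] pq] : exists2 q, E q & p < q.
  have d0 : 0 < sup E - p by lra.
  have [|q Eq h] := @sup_adherent R E _ d0; first by split=> //; exists (1 / 8).
  by exists q => //; lra.
apply: (@rho_cvg0 _ p m) => //; apply: le_lt_trans hm.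
by apply: rho_le; lra.
Qed.

Lemma P_aB_itv {R : realType} (p : R) n : 0 <= p <= 1 ->
  1 - 2 * rho ((1 - p) ^+ 2) n <= P_aB n.+1 p <= 1 - rho ((1 - p) ^+ 2) n
  /\ 0 <= P_aB n.+1 p <= 1.
Proof.
move=> hp; have q01 : 0 <= (1 - p) ^+ 2 <= 1.
  by rewrite sqr_ge0 exprn_ile1 //; lra.
rewrite P_aB_PrA; have := PrA_or2 n q01.
have := PrA_itv n 2 (fun x => nth false x 0 || nth false x 1) q01.
by split; lra.
Qed.

(** [1 - P_aB n.+1 p] lies between [rho] and [2 * rho], so one tends to 0 exactly when the other
    does. *)
Lemma P_aB_cvg {R : realType} (p : R) : 0 <= p <= 1 ->
  (rho ((1 - p) ^+ 2) n @[n --> \oo] --> (1 : R) ->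
   (fun n => P_aB n p) @ \oo --> (0 : R))
  /\ (rho ((1 - p) ^+ 2) n @[n --> \oo] --> (0 : R) <->
      (fun n => P_aB n p) @ \oo --> (1 : R)).
Proof.
move=> hp; have q01 : 0 <= (1 - p) ^+ 2 <= 1.
  by rewrite sqr_ge0 exprn_ile1 //; lra.
split=> [/cvgrPdist_lt cv|].
  apply/cvgrPdist_lt => e e0; have [N _ hN] := cv _ e0.
  exists N.+1 => // -[//|n] /= hn; have := hN n hn; rewrite /=.
  have [h1 h2] := P_aB_itv n hp; have := rho_itv n q01 => h3.
  by rewrite ger0_norm ?sub0r ?normrN ?ger0_norm; lra.
split=> /cvgrPdist_lt cv; apply/cvgrPdist_lt => e e0.
  have e2 : 0 < e / 2 by lra.
  have [N _ hN] := cv _ e2; exists N.+1 => // -[//|n] /= hn.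
  have := hN n hn; rewrite /=.
  have [h1 h2] := P_aB_itv n hp; have := rho_itv n q01 => h3.
  by rewrite sub0r normrN !ger0_norm; lra.
have [N _ hN] := cv _ e0; exists N => // n /= hn.
have := hN n.+1 (leqW hn); rewrite /=.
have [h1 h2] := P_aB_itv n hp; have := rho_itv n q01 => h3.
by rewrite sub0r normrN !ger0_norm; lra.
Qed.

Theorem theorem2 (R : realType) :
  exists pcAb pcaB : R,
    (0 < pcAb < 1) /\ (0 < pcaB < 1) /\
     (forall p : R, 0 <= p <= 1 ->
        ((fun n => P_Ab n p) @ \oo --> (0 : R)) <-> p < pcAb) /\
     (forall p : R, 0 <= p <= 1 -> pcAb < p ->
        (fun n => P_Ab n p) @ \oo --> (1 : R)) /\
     (forall p : R, 0 <= p <= 1 -> p < pcaB ->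
        (fun n => P_aB n p) @ \oo --> (0 : R)) /\
     (forall p : R, 0 <= p <= 1 ->
        ((fun n => P_aB n p) @ \oo --> (1 : R)) <-> pcaB < p).
Proof.
have [pc /andP[pc0 pc1] hpc] := rho_threshold R.
have PAb p : (fun n => P_Ab n p) = (fun n => rho p n).
  by apply/funext => n; rewrite P_Ab_rho.
have s0 : 0 < Num.sqrt pc by rewrite sqrtr_gt0.
have s1 : Num.sqrt pc < 1 by rewrite -sqrtr1 ltr_sqrt.
have sE : pc = Num.sqrt pc ^+ 2 by rewrite sqr_sqrtr // ltW.
(* The map p -> (1 - p)^2 reverses order, so the equivalence at limit 0 for Ab becomes the one at
   limit 1 for aB. *)
exists pc, (1 - Num.sqrt pc); split; first by rewrite pc0.
split; first lra.
split; first by move=> p hp; rewrite PAb; have [] := hpc p hp.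
split; first by move=> p hp; rewrite PAb; have [] := hpc p hp.
have q01 (p : R) : 0 <= p <= 1 -> 0 <= (1 - p) ^+ 2 <= 1.
  by move=> hp; rewrite sqr_ge0 exprn_ile1 //; lra.
split=> p hp; have [c0 c1] := P_aB_cvg hp; have [t0 t1] := hpc _ (q01 p hp).
  move=> ltp; apply/c0/t1; rewrite sE ltr_pXn2r ?nnegrE //; lra.
by rewrite -c1 t0 {1}sE ltr_pXn2r ?nnegrE //; lra.
Qed.
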